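(* Let $n\ge 1$ be an integer, let $\varphi_n$ be the function on $(0,\infty)$ defined recursively in the context, and let $\sigma$ be a real number with $0<\sigma<1$. Then $$\frac{1}{2\pi}\int_{-\infty}^{\infty}\frac{|\zeta(\sigma+it)|^{2n}}{(\sigma^2+t^2)^n}\,dt = \int_0^\infty \varphi_n^2(x)\,x^{-1-2\sigma}\,dx.$$
   Context: $\zeta(s)$ denotes the Riemann zeta-function (given by $\sum_{n\ge1} n^{-s}$ for $\Re s>1$ and by analytic continuation elsewhere). $\{x\} = x-[x]$ denotes the fractional part of the real number $x$, where $[x]$ is the greatest integer not exceeding $x$. The functions $\varphi_n:(0,\infty)\to\mathbb{R}$ are defined by $$\varphi_1(x) := \{x\},\qquad \varphi_n(x) := \int_0^\infty \{u\}\,\varphi_{n-1}\Bigl(\frac{x}{u}\Bigr)\,\frac{du}{u}\quad(n\ge 2),$$ and $\varphi_n^2(x)=(\varphi_n(x))^2$. *)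

(* Defs.v *)
From mathcomp Require Import all_boot all_order all_algebra.
From mathcomp Require Import complex.
From mathcomp Require Import all_classical all_reals all_analysis.

Set Implicit Arguments.
Unset Strict Implicit.
Unset Printing Implicit Defensive.

Import Order.TTheory GRing.Theory Num.Theory.
Import numFieldNormedType.Exports.

Local Open Scope classical_set_scope.
Local Open Scope ring_scope.
Local Open Scope complex_scope.

(* The modulus with values in R; the norm `|z| of R[i] is (cmod z)%:C. *)
Definition cmod (R : realType) (z : R[i]) : R := Normc.normc z.

Definition cexp (R : realType) (z : R[i]) : R[i] :=
  (expR (complex.Re z))%:C * (cos (complex.Im z) +i* sin (complex.Im z)).

(* m ^ (- s) for a natural number m > 0, with the real logarithm of m. *)
Definition natpowN (R : realType) (m : nat) (s : R[i]) : R[i] :=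
  cexp (- s * (ln (m%:R : R))%:C).

(* Analyticity at z0: f is the sum of a power series on a disc around z0. The
   cast to R[i]^o selects the topology of the norm on R[i]. *)
Definition analytic_at (R : realType) (f : R[i] -> R[i]) (z0 : R[i]) : Prop :=
  exists (a : nat -> R[i]) (r : R), 0 < r /\
    forall z : R[i], cmod (z - z0) < r ->
      series (fun k => a k * (z - z0) ^+ k) @ \oo --> (f z : R[i]^o).

(* Since C minus {1} is connected, the identity theorem shows that this
   determines zeta everywhere except at the pole 1, where its value is left
   arbitrary. *)
Definition is_riemann_zeta (R : realType) (zeta : R[i] -> R[i]) : Prop :=
  (forall s : R[i], 1 < complex.Re s ->
     series (fun k => natpowN k.+1 s) @ \oo --> (zeta s : R[i]^o)) /\
  (forall s : R[i], s != 1 -> analytic_at zeta s).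

Definition fracpart (R : realType) (x : R) : R := x - (Num.floor x)%:~R.

(* Only the values at n >= 1 and x > 0 are meaningful. For these the integrand
   is nonnegative and Lebesgue integrable, so that the real-valued integral is
   the genuine one. *)
Fixpoint phi (R : realType) (n : nat) (x : R) : R :=
  match n with
  | 0 => 0
  | 1 => fracpart x
  | (_.+1 as m).+1 =>
      \int[@lebesgue_measure R]_(u in `]0, +oo[)
        (fracpart u * phi m (x / u) / u)
  end.

(* Main.v *)
Require Import Defs.
From HB Require Import structures.
From mathcomp Require Import all_boot all_order all_algebra.
From mathcomp Require Import complex.
From mathcomp Require Import all_classical all_reals all_analysis.
From mathcomp Require Import measurable_realfun.
From mathcomp Require Import ring lra.

(** Let [f y = {e^y} * e^(- sigma * y)] for real [y]. The substitution [x = e^y]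
    turns the multiplicative convolution in the definition of [phi] into the
    additive one, so that [phi n (e^y) * e^(- sigma * y)] is the [n]-fold
    convolution [g] of [f] with itself ([phi_expR]), and the right-hand side of
    the identity is the integral of [g ^+ 2] over the line. The Fourier transform
    of [f] at [t] is [- zeta s / s] with [s = sigma + i t]
    ([power_spectrum_frac_weight]), hence that of [g] is its [n]-th power and the
    integrand on the left is the squared modulus of the Fourier transform of [g].
    The identity is then Plancherel's formula for [g] ([plancherel]).

    Complex-valued integrals are avoided: a Fourier transform is represented by
    its cosine and sine parts, and only its squared modulus, which is
    multiplicative under convolution, matters in the end. Plancherel's formula is
    obtained for nonnegative bounded integrable functions that are continuous off
    a countable set. Their convolutions are continuous by dominated convergence,
    so the autocorrelation [h] of [g] is a continuous function with nonnegative
    Fourier transform, and Fourier inversion of [h] at [0] follows by Abel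
    summation: Fubini's theorem turns the Abel means of the Fourier transform
    into Poisson means of [h], which tend to [pi * h 0], and monotone convergence
    handles the other side.

    The value of the Fourier transform of [f] rests on
    [zeta s = s / (s - 1) - s * K s], where [K s] is the integral of
    [{e^y} * e^(- s * y)] over [y >= 0]. For [Re s > 1] this is the Dirichlet series
    written as an integral against [floor (e^y)]. Along a horizontal line that is
    not the real axis, both sides are real-analytic functions of [Re s > 0], so
    they agree there by the identity theorem in one real variable. The remaining
    point [t = 0] has measure zero. *)

Set Implicit Arguments.
Unset Strict Implicit.
Unset Printing Implicit Defensive.

Import Order.TTheory GRing.Theory Num.Theory.
Import numFieldNormedType.Exports.

Local Open Scope classical_set_scope.
Local Open Scope ring_scope.

(** * Lebesgue integrals of real-valued functions *)

Section lebesgue.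
Context {R : realType}.
Local Notation mu := (@lebesgue_measure R).
Local Notation integ D f := (mu.-integrable D (EFin \o f)).
Implicit Types (D : set R) (f g k : R -> R).

Lemma integ_le D f g : measurable D -> measurable_fun D f -> integ D g ->
  (forall x, D x -> `|f x| <= g x) -> integ D f.
Proof.
move=> mD mf ig fg; apply: le_integrable ig => //.
  exact/measurable_EFinP.
move=> x Dx; rewrite lee_fin (le_trans (fg _ Dx))// ler_norm//.
Qed.

Lemma integ_measurable D f : integ D f -> measurable_fun D f.
Proof. by move=> /(measurable_int mu) /measurable_EFinP. Qed.

Lemma integ_mul_bounded D f k M : measurable D -> integ D f ->
  measurable_fun D k -> (forall x, D x -> `|k x| <= M) ->
  integ D (fun x => f x * k x).
Proof.
move=> mD i_f mk kM.
apply: (@integ_le _ _ (fun x => M * `|f x|)) => //.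
- by apply: measurable_funM => //; exact: integ_measurable.
- exact: (@integrableZl _ _ _ mu D mD M (EFin \o (Num.norm \o f)) (@integrable_norm _ _ _ mu _ _ i_f)).
- by move=> x Dx; rewrite normrM mulrC ler_wpM2r// kM.
Qed.

Lemma integD D f g : measurable D -> integ D f -> integ D g ->
  integ D (fun x => f x + g x).
Proof. by move=> mD i_f ig; apply: (@integrableD _ _ _ mu D mD (EFin \o f) (EFin \o g)). Qed.

Lemma integZ D f (c : R) : measurable D -> integ D f ->
  integ D (fun x => c * f x).
Proof. by move=> mD i_f; apply: (@integrableZl _ _ _ mu D mD c (EFin \o f)). Qed.

Lemma Rintegral_lincomb D f g (a b : R) : measurable D ->
  integ D f -> integ D g ->
  \int[mu]_(x in D) (a * f x + b * g x) =
  a * \int[mu]_(x in D) f x + b * \int[mu]_(x in D) g x.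
Proof.
by move=> mD i_f ig; rewrite RintegralD ?RintegralZl//; exact: integZ.
Qed.

Lemma EFin_Rintegral D f : measurable D -> integ D f ->
  ((\int[mu]_(x in D) f x)%:E = \int[mu]_(x in D) (f x)%:E)%E.
Proof.
by move=> mD i_f; rewrite /Rintegral fineK//; exact: integrable_fin_num.
Qed.

Lemma Rdominated_cvg D (u : nat -> R -> R) f g : measurable D ->
  (forall n, measurable_fun D (u n)) -> measurable_fun D f ->
  {ae mu, forall x, D x -> u ^~ x @ \oo --> f x} -> integ D g ->
  (forall n x, D x -> `|u n x| <= g x) ->
  (\int[mu]_(x in D) u n x @[n --> \oo] --> \int[mu]_(x in D) f x)%R.
Proof.
move=> mD mu_ mf uf ig ug.
have [||||i_f _] := @dominated_convergence _ _ _ mu D mD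
    (fun n => EFin \o u n) (EFin \o f) (EFin \o g) _ _ _ ig.
- by move=> n; apply/measurable_EFinP; exact: mu_.
- by apply/measurable_EFinP; exact: mf.
- case: uf => N [mN N0 subN]; exists N; split => // x /= nuf; apply: subN => /=.
  apply: contra_not nuf => /[apply] ufx.
  by apply: cvg_EFin => //; exact: nearW.
- by apply: aeW => x n Dx /=; rewrite lee_fin ug.
by move=> cv; apply: fine_cvg; rewrite EFin_Rintegral.
Qed.

Lemma lebesgue_measure_shift (a : R) (A : set R) : measurable A ->
  pushforward mu ((fun x => x + a) : _ -> measurableTypeR R) A = mu A.
Proof.
have ms : measurable_fun setT ((fun x => x + a) : R -> measurableTypeR R).
  by apply: measurable_funD => //; exact: measurable_id.
move=> mA; apply/esym/lebesgue_measure_unique => //= _ [[b c]] _ <-.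
rewrite /pushforward/=.
have -> : (fun x => x + a) @^-1` `]b, c] = `]b - a, c - a]%classic.
  by apply/seteqP; split => x /=; rewrite !in_itv/= ltrBlDr lerBrDr.
rewrite !lebesgue_measure_itv/= !lte_fin.
by rewrite ltrD2r; case: ifP => // _; rewrite -!EFinD; congr EFin; ring.
Qed.

(** Translations and the reflection are the instances of [tau] used below. *)
Section invariance.
Context (tau : R -> R) (mtau : measurable_fun setT tau)
  (tauE : forall A : set R, measurable A ->
    pushforward mu (tau : _ -> measurableTypeR R) A = mu A).

Lemma ge0_integral_invariant (f : R -> \bar R) :
  measurable_fun setT f -> (forall x, 0 <= f x)%E ->
  (\int[mu]_x f (tau x) = \int[mu]_x f x)%E.
Proof.
move=> mf f0; transitivity (\int[pushforward mu (tau : _ -> measurableTypeR R)]_x f x)%E.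
  by rewrite ge0_integral_pushforward.
by apply: eq_measure_integral => //= A mA AS; exact: tauE.
Qed.

Lemma integ_invariant f : integ setT f -> integ setT (f \o tau).
Proof.
move=> /integrableP[mf fy]; apply/integrableP; split.
  by apply: (measurableT_comp mf).
rewrite (@ge0_integral_invariant (fun x => `|(f x)%:E|)%E) => //.
exact: measurableT_comp.
Qed.

Lemma Rintegral_invariant f : integ setT f ->
  \int[mu]_x f (tau x) = \int[mu]_x f x.
Proof.
move=> i_f; congr fine.
transitivity (\int[pushforward mu (tau : _ -> measurableTypeR R)]_x (f x)%:E)%E.
  rewrite integral_pushforward//.
    exact: (measurable_int mu).
  exact: integ_invariant.
by apply: eq_measure_integral => //= A mA AS; exact: tauE.
Qed.

End invariance.

Lemma lebesgue_tonelli (F : R * R -> \bar R) : measurable_fun setT F ->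
  (forall z, 0 <= F z)%E ->
  (\int[mu]_x \int[mu]_y F (x, y) = \int[mu]_y \int[mu]_x F (x, y))%E.
Proof. exact: (@fubini_tonelli _ _ _ _ _ mu mu). Qed.

Lemma Rfubini (F G : R * R -> R) :
  measurable_fun setT F -> measurable_fun setT G -> (forall z, `|F z| <= G z) ->
  (forall x, integ setT (fun y => F (x, y))) ->
  (forall y, integ setT (fun x => F (x, y))) ->
  (\int[mu]_x \int[mu]_y (G (x, y))%:E < +oo)%E ->
  \int[mu]_x \int[mu]_y F (x, y) = \int[mu]_y \int[mu]_x F (x, y).
Proof.
move=> mF mG FG i1 i2 Gy; rewrite /Rintegral; congr fine.
under eq_integral => x _ do rewrite -/(Rintegral _ _ _) EFin_Rintegral//.
under [RHS]eq_integral => y _ do rewrite -/(Rintegral _ _ _) EFin_Rintegral//.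
have iG : (mu \x mu)%E.-integrable setT (EFin \o G).
  apply/integrable12ltyP; first exact/measurable_EFinP.
  apply: le_lt_trans Gy; rewrite le_eqVlt; apply/orP; left; apply/eqP.
  apply: eq_integral => x _; apply: eq_integral => y _.
  by rewrite /= ger0_norm// (le_trans (normr_ge0 _) (FG _)).
apply: (@Fubini _ _ _ _ _ mu mu (EFin \o F)).
apply: le_integrable iG => //; first exact/measurable_EFinP.
by move=> z _; rewrite lee_fin (le_trans (FG z))// ler_norm.
Qed.

End lebesgue.

(** * The substitution x = e^y *)

Section exp_substitution.
Context {R : realType}.
Local Notation mu := (@lebesgue_measure R).

Lemma ge0_integral_opp (f : R -> \bar R) :
  measurable_fun setT f -> (forall x, 0 <= f x)%E ->
  (\int[mu]_x f (- x)%R = \int[mu]_x f x)%E.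
Proof.
move=> mf f0; apply: (ge0_integral_invariant (tau := -%R)) => //.
exact: lebesgue_measureN.
Qed.

Lemma integral_expR_Ny (b : R) :
  (\int[mu]_(y in `]-oo, b]) (expR y)%:E = (expR b)%:E)%E.
Proof.
rewrite integral_mkcond -ge0_integral_opp; first last.
- by move=> x; rewrite patchE; case: ifP => // _; rewrite lee_fin expR_ge0.
- apply/(measurable_restrictT (EFin \o expR)) => //.
  by apply/measurable_funTS/measurable_EFinP; exact: measurable_expR.
transitivity (\int[mu]_(y in `[(- b)%R, +oo[) (expR (- y))%:E)%E.
  rewrite [RHS]integral_mkcond; apply: eq_integral => x _ /=.
  rewrite !patchE; congr (if _ then _ else _).
  by apply/idP/idP; rewrite !inE/= !in_itv/= ?andbT lerNl.
rewrite (@ge0_continuous_FTC2y _ (fun y => expR (- y)) (fun y => - expR (- y)) _ 0).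
- by rewrite -EFinB sub0r !opprK.
- by move=> x _; exact: expR_ge0.
- apply: continuous_subspaceT => x; apply: continuous_comp => //.
    exact: continuousN.
  exact: continuous_expR.
- by rewrite -oppr0; apply: cvgN; exact: cvgr_expR.
- by move=> x _; exact: ex_derive.
- apply: cvg_at_right_filter; apply: cvgN.
  apply: (@continuous_comp _ _ _ -%R) => //; first exact: continuousN.
  exact: continuous_expR.
- by move=> x _; rewrite derive1E derive_val; ring.
Qed.

Lemma ler_expR_ln (b y : R) : 0 < b -> (expR y <= b) = (y <= ln b).
Proof. by move=> b0; rewrite -[X in _ <= X]lnK ?posrE// ler_expR. Qed.

Lemma ltr_ln_expR (b y : R) : 0 < b -> (b < expR y) = (ln b < y).
Proof. by move=> b0; rewrite -[X in X < _]lnK ?posrE// ltr_expR. Qed.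

(** The image of [expR y dy] under [expR]. *)
Definition exp_image_measure (A : set (measurableTypeR R)) : \bar R :=
  (\int[mu]_(y in expR @^-1` A) (expR y)%:E)%E.
Local Notation nu := exp_image_measure.

Let preimage_measurable (A : set R) :
  measurable A -> measurable ((@expR R) @^-1` A).
Proof. by move=> mA; rewrite -[_ @^-1` _]setTI; exact: measurable_expR. Qed.

Let nu0 : nu set0 = 0%E.
Proof. by rewrite /exp_image_measure preimage_set0 integral_set0. Qed.

Let nu_ge0 A : (0 <= nu A)%E.
Proof. by apply: integral_ge0 => x _; rewrite lee_fin expR_ge0. Qed.

Let nu_sigma_additive : semi_sigma_additive nu.
Proof.
move=> /= F mF tF mUF; rewrite /exp_image_measure; apply: cvg_toP.
  apply: ereal_nondecreasing_is_cvgn => m n mn.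
  by apply: lee_sum_nneg_natr => // k _ _; exact: nu_ge0.
rewrite preimage_bigcup ge0_integral_bigcup//=.
- by move=> k; exact: (preimage_measurable (mF k)).
- by apply/measurable_funTS/measurable_EFinP; exact: measurable_expR.
- apply/trivIsetP => i j _ _ ij; rewrite -preimage_setI.
  by move/trivIsetP : tF => /(_ i j Logic.I Logic.I ij) ->; rewrite preimage_set0.
Qed.

HB.instance Definition _ := isMeasure.Build _ (measurableTypeR R) _
  nu nu0 nu_ge0 nu_sigma_additive.

Let nu_oc (a b : R) : 0 <= a -> nu `]a, b] = mu `]a, b].
Proof.
move=> a0; rewrite /exp_image_measure lebesgue_measure_itv/= lte_fin; case: ifPn => [ab|]; last first.
  rewrite -leNgt => ba; rewrite set_itv_ge ?preimage_set0 ?integral_set0//.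
  by rewrite bnd_simp -leNgt.
have b0 : 0 < b by exact: le_lt_trans ab.
move: a0; rewrite le_eqVlt => /predU1P[a0|a0].
  rewrite -a0 oppr0 adde0.
  transitivity (\int[mu]_(y in `]-oo, ln b]) (expR y)%:E)%E.
    congr (integral _ _ _); apply/seteqP; split => x /=;
      by rewrite !in_itv/= expR_gt0/= ler_expR_ln.
  by rewrite integral_expR_Ny lnK.
have lab : ln a < ln b by rewrite ltr_ln.
transitivity (\int[mu]_(y in `[ln a, ln b]) (expR y)%:E)%E.
  rewrite -integral_itv_obnd_cbnd.
    congr (integral _ _ _); apply/seteqP; split => x /=;
      by rewrite !in_itv/= ler_expR_ln// ltr_ln_expR.
  by apply/measurable_funTS/measurable_EFinP; exact: measurable_expR.
rewrite (@continuous_FTC2 _ _ expR)//.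
- by rewrite !lnK.
- by apply: continuous_subspaceT; exact: continuous_expR.
- split.
  + by move=> x _; exact: derivable_expR.
  + by apply: cvg_at_right_filter; exact: continuous_expR.
  + by apply: cvg_at_left_filter; exact: continuous_expR.
- by move=> x _; rewrite derive1E; apply: derive_val.
Qed.

(** Adding the restriction of Lebesgue measure to the nonpositive half-line
    makes [exp_image_measure] a measure to which the uniqueness of Lebesgue
    measure on half-open intervals applies. *)
Lemma lebesgue_measure_exp (A : set R) : measurable A -> A `<=` `]0, +oo[ ->
  mu A = (\int[mu]_(y in expR @^-1` A) (expR y)%:E)%E.
Proof.
move=> mA A0; have mN : measurable (`]-oo, 0] : set (measurableTypeR R)).
  exact: measurable_itv.
pose m := measure_add nu (mrestr mu mN).
have mE B : m B = (nu B + mu (B `&` `]-oo, 0%R]))%E by rewrite /m measure_addE.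
transitivity (m A).
  apply: lebesgue_measure_unique => // _ [[a b]] _ <-.
  change (mu `]a, b]%classic = m `]a, b]%classic); rewrite mE.
  have mab : measurable `]a, b]%classic by exact: measurable_itv.
  rewrite (_ : nu _ = nu `]Num.max a 0, b]).
    rewrite nu_oc ?le_max ?lexx ?orbT//.
    rewrite (measureDI mu mab mN); congr (mu _ + _)%E.
    apply/seteqP; split => x /=; rewrite !in_itv/= gt_max.
      by move=> [/andP[-> ->] /negP]; rewrite -ltNge => ->.
    by move=> /andP[/andP[-> x0] ->]; split => //; apply/negP; rewrite -ltNge.
  congr (integral _ _ _); apply/seteqP; split => x /=;
      by rewrite !in_itv/= gt_max expR_gt0 ?andbT.
rewrite mE (_ : A `&` _ = set0) ?measure0 ?adde0//.
by apply/seteqP; split => x //= [/A0 /=]; rewrite !in_itv/= andbT ltNge => /negP.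
Qed.

Lemma measurable_subgraph (D : set R) (f : R -> R) :
  measurable D -> measurable_fun D f ->
  measurable [set z : R * R | D z.1 /\ 0 < z.2 < f z.1].
Proof.
move=> mD mf.
have mD1 : measurable (D `*` [set: R]) by exact: measurableX.
have mf1 : measurable_fun (D `*` [set: R]) (fun z : R * R => f z.1).
  apply: (measurable_comp mD) => //; first by move=> _ [z [Dz _] <-].
  exact: measurable_funTS measurable_fst.
have m2 : measurable_fun (D `*` [set: R]) (fun z : R * R => z.2).
  exact: measurable_funTS measurable_snd.
rewrite (_ : [set z | _] = (D `*` setT) `&` [set z | 0 < z.2] `&`
   ((D `*` setT) `&` [set z | z.2 < f z.1])).
  apply: measurableI.
    by apply: (@measurable_lte _ _ _ _ mD1 (EFin \o cst 0) (EFin \o snd)) => //;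
      apply/measurable_EFinP.
  by apply: (@measurable_lte _ _ _ _ mD1 (EFin \o snd) (EFin \o (f \o fst))) => //;
    apply/measurable_EFinP.
apply/seteqP; split => -[x t]/=.
  by move=> [Dx /andP[-> ->]].
by move=> [[[Dx _] t0] [_ tf]]; split => //; rewrite t0.
Qed.

(** Both sides are, by Tonelli, the integral over the heights [t] of the
    measures of the superlevel sets of [f], so that the statement for sets
    suffices. *)
Lemma ge0_integral_expR (f : R -> R) : measurable_fun (`]0, +oo[ : set R) f ->
  (forall x, 0 < x -> 0 <= f x) ->
  (\int[mu]_(x in `]0%R, +oo[) (f x)%:E =
   \int[mu]_y (f (expR y) * expR y)%:E)%E.
Proof.
move=> mf f0.
pose S := [set z : R * R | `]0, +oo[%classic z.1 /\ 0 < z.2 < f z.1].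
have mS : measurable S by exact: measurable_subgraph.
have layer x : 0 < x -> ((f x)%:E = \int[mu]_t (\1_S (x, t))%:E)%E.
  move=> x0; rewrite (_ : (fun t => _) = (fun t => (\1_`]0, f x[ t)%:E)).
    transitivity (mu `]0, f x[%classic); last first.
      by rewrite integral_indic ?setIT//; exact: measurable_itv.
    rewrite lebesgue_measure_itv/= lte_fin oppr0 adde0.
    by case: ifPn => //; rewrite -leNgt => fx0; congr EFin; apply/le_anti/andP; split => //; exact: f0.
  apply/funext => t; rewrite !indicE; congr ((nat_of_bool _)%:R%:E).
  by apply/idP/idP; rewrite !inE /S/= !in_itv/= andbT => // -[].
transitivity (\int[mu]_x \int[mu]_t (\1_S (x, t))%:E)%E.
  rewrite integral_mkcond; apply: eq_integral => x _; rewrite patchE.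
  case: ifPn => [|]; first by rewrite inE/= in_itv/= andbT => /layer.
  rewrite notin_setE/= => x0; rewrite integral0_eq// => t _.
  by rewrite indicE memNset// => -[].
have mS1 : measurable_fun setT (fun z : R * R => (\1_S z : R)%:E).
  by apply/measurable_EFinP; exact: measurable_indic.
transitivity (\int[mu]_t \int[mu]_x (\1_S (x, t))%:E)%E.
  by apply: (lebesgue_tonelli mS1) => z; rewrite lee_fin.
pose P y t := (\1_S (expR y, t) * expR y)%:E.
transitivity (\int[mu]_t \int[mu]_y P y t)%E.
  apply: eq_integral => t _.
  rewrite (_ : (fun x => _) = (fun x => (\1_(ysection S t) x)%:E)); last first.
    by apply/funext => x; rewrite !indicE mem_ysection.
  transitivity (mu (ysection S t)).
    by rewrite integral_indic ?setIT//; exact: measurable_ysection.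
  rewrite lebesgue_measure_exp; first last.
  - by move=> x; rewrite /ysection/= inE => -[].
  - exact: measurable_ysection.
  rewrite integral_mkcond; apply: eq_integral => y _; rewrite /P patchE indicE.
  rewrite -mem_ysection; case: ifPn; rewrite ?inE/= => h.
    by rewrite (_ : expR y \in _) ?mul1r//; rewrite inE.
  by move: h; rewrite notin_setE => h; rewrite memNset ?mul0r.
rewrite -(@lebesgue_tonelli _ (fun z => P z.1 z.2))/=; last 2 first.
- apply/measurable_EFinP; apply: measurable_funM.
    rewrite /=; apply: (@measurableT_comp _ _ _ _ _ _ (\1_S : R * R -> R)).
      exact: measurable_indic.
    apply: measurable_fun_pair; last exact: measurable_snd.
    by apply: measurableT_comp => //; exact: measurable_expR.
  by apply: measurableT_comp => //; exact: measurable_expR.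
- by move=> z; rewrite lee_fin mulr_ge0// expR_ge0.
apply: eq_integral => y _; rewrite /P.
transitivity (\int[mu]_t ((expR y)%:E * (\1_S (expR y, t))%:E))%E.
  by apply: eq_integral => t _; rewrite -EFinM mulrC.
rewrite ge0_integralZl ?lee_fin ?expR_ge0//; last first.
  exact: (measurable_fun_pair2 (f := fun z : R * R => (\1_S z : R)%:E)).
by rewrite -layer ?expR_gt0// -EFinM mulrC.
Qed.

End exp_substitution.

(** * Laplace integrals of the cosine and the sine *)

Section laplace_integrals.
Context {R : realType}.
Local Notation mu := (@lebesgue_measure R).
Local Notation integ D f := (mu.-integrable D (EFin \o f)).
Implicit Types (f F : R -> R) (a c l t x y : R).

Lemma measurable_continuous f : continuous f -> measurable_fun setT f.
Proof. exact: continuous_measurable_fun. Qed.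

(** Without a sign condition on [f], the half-line is reached from the segments
    [[a, a + n]] by dominated convergence, with [`|f|] as the bound. *)
Lemma Rintegral_FTC2y f F a l : continuous f ->
  (forall x, is_derive x 1 F (f x)) -> integ `[a, +oo[ f ->
  F x @[x --> +oo] --> l ->
  \int[mu]_(x in `[a, +oo[) f x = l - F a.
Proof.
move=> cf dF i_f Fl.
have cF : continuous F.
  by move=> x; apply: differentiable_continuous; apply/derivable1_diffP; case: (dF x).
pose u (n : nat) x := f x * \1_(`[a, a + n.+1%:R]) x.
have mf : measurable_fun setT f by exact: measurable_continuous.
have cu : \int[mu]_(x in `[a, +oo[) u n x @[n --> \oo] -->
    \int[mu]_(x in `[a, +oo[) f x.
  apply: (@Rdominated_cvg _ _ _ _ (fun x => `|f x|)) => //.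
  - by move=> n; apply/measurable_funTS/measurable_funM => //; exact: measurable_indic.
  - exact: measurable_funTS.
  - apply: aeW => x /=; rewrite in_itv/= andbT => ax.
    apply: cvg_near_cst; near=> n.
    rewrite /u indicE mem_set ?mulr1//= in_itv/= ax/= -lerBlDl.
    apply: le_trans (_ : n%:R <= _); last by rewrite ler_nat.
    near: n; exact: nbhs_infty_ger.
  - exact: (integrable_norm i_f).
  - move=> n x _; rewrite /u normrM ler_piMr// indicE.
    by case: (_ \in _); rewrite ?normr1 ?normr0.
have uE n : \int[mu]_(x in `[a, +oo[) u n x = F (a + n.+1%:R) - F a.
  have an : a < a + n.+1%:R by rewrite ltrDl.
  transitivity (\int[mu]_(x in `[a, a + n.+1%:R]) f x).
    rewrite Rintegral_mkcond [RHS]Rintegral_mkcond; apply: eq_Rintegral => x _.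
    rewrite !patchE /u indicE !mem_setE !in_itv/= andbT.
    by case: (a <= x) => //=; case: (x <= _) => /=; rewrite ?mulr1 ?mulr0.
  rewrite /Rintegral (@continuous_FTC2 _ f F)//.
  - by apply: continuous_subspaceT.
  - split.
    + by move=> x _; case: (dF x).
    + by apply: cvg_at_right_filter; exact: cF.
    + by apply: cvg_at_left_filter; exact: cF.
  - by move=> x _; rewrite derive1E derive_val.
have : \int[mu]_(x in `[a, +oo[) u n x @[n --> \oo] --> l - F a.
  under eq_fun do rewrite uE.
  apply: cvgB; last exact: cvg_cst.
  apply: (cvg_comp _ _ _ Fl).
  apply/cvgryPge => A; near=> n.
  rewrite -lerBlDl (@le_trans _ _ n%:R) ?ler_nat//.
  near: n; exact: nbhs_infty_ger.
exact: (cvg_unique _ cu).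
Unshelve. all: by end_near.
Qed.

Lemma cvg_expRNM c : 0 < c -> expR (- c * x) @[x --> +oo] --> (0 : R).
Proof.
move=> c0.
rewrite (_ : (fun x => expR (- c * x)) =
             (fun z => expR (- z)) \o (fun z => c * z)); last first.
  by apply: eq_fun => x; rewrite mulNr.
by apply: (@cvg_comp _ _ _ _ _ _ (pinfty_nbhs R)); [exact: gt0_cvgMry | exact: cvgr_expR].
Qed.

Lemma continuous_expRM c : continuous (fun x : R => expR (c * x)).
Proof.
move=> x; apply: continuous_comp; last exact: continuous_expR.
exact: mulrl_continuous.
Qed.

Lemma continuous_cosM c : continuous (fun x : R => cos (c * x)).
Proof.
move=> x; apply: continuous_comp; last exact: continuous_cos.
exact: mulrl_continuous.
Qed.

Lemma continuous_sinM c : continuous (fun x : R => sin (c * x)).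
Proof.
move=> x; apply: continuous_comp; last exact: continuous_sin.
exact: mulrl_continuous.
Qed.

Lemma norm_cos_le1 x : `|cos x| <= 1.
Proof. by rewrite ler_norml cos_geN1 cos_le1. Qed.

Lemma norm_sin_le1 x : `|sin x| <= 1.
Proof. by rewrite ler_norml sin_geN1 sin_le1. Qed.

Lemma integ_expRNM c : 0 < c -> integ `[0, +oo[ (fun x => expR (- c * x)).
Proof.
move=> c0; apply/integrableP; split.
  apply/measurable_EFinP; apply: measurable_funTS; apply: measurable_continuous.
  exact: continuous_expRM.
under eq_integral => x _ do rewrite /= ger0_norm ?expR_ge0//.
rewrite (@ge0_continuous_FTC2y _ _ (fun x => - c^-1 * expR (- c * x)) _ 0).
- by rewrite -EFinB ltry.
- by move=> x _; exact: expR_ge0.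
- by apply: continuous_subspaceT; exact: continuous_expRM.
- by rewrite -[0](mulr0 (- c^-1)); apply: cvgMr; exact: cvg_expRNM.
- by move=> x _; exact: ex_derive.
- apply: cvg_at_right_filter; apply: cvgMr; exact: continuous_expRM.
- move=> x _; rewrite derive1E derive_val /GRing.scale/=.
  by field; rewrite gt_eqF.
Qed.

Lemma cvg_expRNM_bounded c (k : R -> R) M : 0 < c -> (forall x, `|k x| <= M) ->
  expR (- c * x) * k x @[x --> +oo] --> 0.
Proof.
move=> c0 kM; apply/norm_cvg0P.
apply: (@squeeze_cvgr _ _ _ _ (cst 0) (fun x => expR (- c * x) * M)).
- apply: nearW => x; rewrite normr_ge0/= normrM ger0_norm ?expR_ge0//.
  by rewrite ler_wpM2l ?expR_ge0.
- exact: cvg_cst.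
- by rewrite -[0](mul0r M); apply: cvgMl; exact: cvg_expRNM.
Qed.

Lemma integ_expRNM_bounded c (k : R -> R) M : 0 < c ->
  continuous k -> (forall x, `|k x| <= M) ->
  integ `[0, +oo[ (fun x => expR (- c * x) * k x).
Proof.
move=> c0 ck kM; apply: (@integ_mul_bounded _ _ _ _ M) => //.
- exact: integ_expRNM.
- by apply: measurable_funTS; exact: measurable_continuous.
Qed.

Lemma sumsqr_gt0 c t : 0 < c -> 0 < c ^+ 2 + t ^+ 2.
Proof. by move=> c0; rewrite ltr_wpDr ?sqr_ge0// exprn_gt0. Qed.

Lemma Rintegral_expRN_cos c t : 0 < c ->
  \int[mu]_(y in `[0, +oo[) (expR (- c * y) * cos (t * y)) =
  c / (c ^+ 2 + t ^+ 2).
Proof.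
move=> c0; have ct := sumsqr_gt0 t c0.
pose k y := (t * sin (t * y) - c * cos (t * y)) / (c ^+ 2 + t ^+ 2).
have dF x : is_derive x 1 (fun y => expR (- c * y) * k y)
    (expR (- c * x) * cos (t * x)).
  apply: is_derive_eq; rewrite /k /GRing.scale/=.
  by field; rewrite gt_eqF.
rewrite (Rintegral_FTC2y (l := 0) _ dF).
- by rewrite /k !mulr0 expR0 sin0 cos0; field; rewrite gt_eqF.
- move=> x; apply: cvgM; [exact: continuous_expRM|exact: continuous_cosM].
- apply: (@integ_expRNM_bounded _ _ 1) => //; first exact: continuous_cosM.
  by move=> x; exact: norm_cos_le1.
- apply: (@cvg_expRNM_bounded _ _ ((`|t| + `|c|) / (c ^+ 2 + t ^+ 2))) => // x.
  rewrite normrM [X in _ * X]gtr0_norm ?invr_gt0// ler_wpM2r ?invr_ge0 ?(ltW ct)//.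
  by rewrite (le_trans (ler_normB _ _))// lerD// normrM ler_piMr//
     ?norm_sin_le1 ?norm_cos_le1.
Qed.

Lemma Rintegral_expRN_sin c t : 0 < c ->
  \int[mu]_(y in `[0, +oo[) (expR (- c * y) * sin (t * y)) =
  t / (c ^+ 2 + t ^+ 2).
Proof.
move=> c0; have ct := sumsqr_gt0 t c0.
pose k y := - (c * sin (t * y) + t * cos (t * y)) / (c ^+ 2 + t ^+ 2).
have dF x : is_derive x 1 (fun y => expR (- c * y) * k y)
    (expR (- c * x) * sin (t * x)).
  apply: is_derive_eq; rewrite /k /GRing.scale/=.
  by field; rewrite gt_eqF.
rewrite (Rintegral_FTC2y (l := 0) _ dF).
- by rewrite /k !mulr0 expR0 sin0 cos0; field; rewrite gt_eqF.
- move=> x; apply: cvgM; [exact: continuous_expRM|exact: continuous_sinM].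
- apply: (@integ_expRNM_bounded _ _ 1) => //; first exact: continuous_sinM.
  by move=> x; exact: norm_sin_le1.
- apply: (@cvg_expRNM_bounded _ _ ((`|c| + `|t|) / (c ^+ 2 + t ^+ 2))) => // x.
  rewrite normrM [X in _ * X]gtr0_norm ?invr_gt0// ler_wpM2r ?invr_ge0 ?(ltW ct)//.
  by rewrite normrN (le_trans (ler_normD _ _))// lerD// normrM ler_piMr//
     ?norm_sin_le1 ?norm_cos_le1.
Qed.

End laplace_integrals.

(** * Convolution and Fourier transform *)

Section fourier.
Context {R : realType}.
Local Notation mu := (@lebesgue_measure R).
Local Notation integ D f := (mu.-integrable D (EFin \o f)).
Implicit Types (f g k : R -> R) (t x y : R).

Lemma integ_shift f y : integ setT f -> integ setT (fun x => f (x + y)).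
Proof.
apply: (integ_invariant (tau := fun x => x + y)); last exact: lebesgue_measure_shift.
by apply: measurable_funD => //; exact: measurable_id.
Qed.

Lemma Rintegral_shift f y : integ setT f ->
  \int[mu]_x f (x + y) = \int[mu]_x f x.
Proof.
apply: (Rintegral_invariant (tau := fun x => x + y)); last exact: lebesgue_measure_shift.
by apply: measurable_funD => //; exact: measurable_id.
Qed.

Lemma integ_opp f : integ setT f -> integ setT (fun x => f (- x)).
Proof.
by apply: (integ_invariant (tau := -%R)) => //; exact: lebesgue_measureN.
Qed.

Lemma Rintegral_opp f : integ setT f -> \int[mu]_x f (- x) = \int[mu]_x f x.
Proof.
by apply: (Rintegral_invariant (tau := -%R)) => //; exact: lebesgue_measureN.
Qed.

(** A class of functions that is closed under convolution and reflection, and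
    in which translation is continuous under the integral sign by dominated
    convergence alone: off a countable set, values at translates converge. *)
Record nice (g : R -> R) : Prop := Nice {
  nice_ge0 : forall x, 0 <= g x ;
  nice_bounded : exists M, forall x, g x <= M ;
  nice_integ : integ setT g ;
  nice_continuous : exists2 N : set R, countable N &
    forall x, ~ N x -> {for x, continuous g} }.

Definition conv f g x : R := \int[mu]_u (f u * g (x - u)).

Lemma nice_measurable g : nice g -> measurable_fun setT g.
Proof. by move=> /nice_integ /integ_measurable. Qed.

Lemma nice_reflect g : nice g -> nice (fun x => g (- x)).
Proof.
move=> [g0 [M gM] ig [N cN gN]]; split => //; first by exists M.
- exact: integ_opp.
- exists (-%R @` N); first exact: (sub_countable (card_image_le _ _)).
  move=> x Nx; apply: continuous_comp; first exact: continuousN.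
  by apply: gN => NNx; apply: Nx; exists (- x) => //; rewrite opprK.
Qed.

Lemma nice_conv_integ f g x : nice f -> nice g ->
  integ setT (fun u => f u * g (x - u)).
Proof.
move=> nf ng; have [M gM] := nice_bounded ng.
apply: (@integ_mul_bounded _ _ _ _ M) => //; first exact: nice_integ.
- apply: measurableT_comp; first exact: nice_measurable.
  by apply: measurable_funB => //; exact: measurable_id.
- by move=> u _; rewrite ger0_norm ?nice_ge0.
Qed.

Lemma conv_ge0 f g x : nice f -> nice g -> 0 <= conv f g x.
Proof.
by move=> nf ng; apply: Rintegral_ge0 => u _; rewrite mulr_ge0// nice_ge0.
Qed.

(** For fixed [x], the points [u] at which [g] is discontinuous at [x - u] form
    a countable set, so the integrand converges almost everywhere. *)
Lemma continuous_conv f g : nice f -> nice g -> continuous (conv f g).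
Proof.
move=> nf ng x; apply/continuous_withinNx/cvgr_dnbhsP => w [_ wx].
have [M gM] := nice_bounded ng; have [N cN gN] := nice_continuous ng.
apply: (@Rdominated_cvg _ _ _ _ (fun u => M * f u)) => //.
- by move=> n; apply: integ_measurable; exact: nice_conv_integ.
- by apply: integ_measurable; exact: nice_conv_integ.
- have cxN : countable [set x - v | v in N].
    exact: (sub_countable (card_image_le _ _) cN).
  exists [set x - v | v in N]; split.
  + exact: countable_measurable.
  + exact: countable_lebesgue_measure0.
  + move=> u /= nu; apply: contrapT => Nu; apply: nu => _.
    apply: cvgMr; apply: (@cvg_comp _ _ _ (fun n => w n - u) g _ (nbhs (x - u))).
      by apply: cvgB => //; exact: cvg_cst.
    by apply: gN => NN; apply: Nu; exists (x - u) => //; rewrite subKr.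
- by apply: integZ => //; exact: nice_integ.
- move=> n u _; rewrite ger0_norm ?mulr_ge0 ?nice_ge0// mulrC.
  by rewrite ler_wpM2r ?nice_ge0.
Qed.

Lemma measurable_conv_kernel f g : nice f -> nice g ->
  measurable_fun setT (fun z : R * R => f z.1 * g (z.2 - z.1)).
Proof.
move=> nf ng; apply: measurable_funM.
  by apply: (measurableT_comp (nice_measurable nf)); exact: measurable_fst.
apply: (measurableT_comp (nice_measurable ng)).
by apply: measurable_funB; [exact: measurable_snd|exact: measurable_fst].
Qed.

Lemma integral_conv_kernel f g : nice f -> nice g ->
  (\int[mu]_u \int[mu]_y (f u * g (y - u))%:E =
   (\int[mu]_x f x * \int[mu]_x g x)%:E)%E.
Proof.
move=> nf ng; rewrite mulrC EFinM (EFin_Rintegral _ (nice_integ nf))//.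
rewrite -ge0_integralZl//; last 3 first.
- by apply/measurable_EFinP; exact: nice_measurable.
- by move=> x _; rewrite lee_fin nice_ge0.
- by rewrite lee_fin; apply: Rintegral_ge0 => x _; exact: nice_ge0.
apply: eq_integral => u _.
have ig := integ_shift (- u) (nice_integ ng).
rewrite -EFinM -(Rintegral_shift (- u) (nice_integ ng)) mulrC -RintegralZl//.
by rewrite EFin_Rintegral//; exact: integZ.
Qed.

Lemma nice_conv f g : nice f -> nice g -> nice (conv f g).
Proof.
move=> nf ng; have [M gM] := nice_bounded ng; split.
- by move=> x; exact: conv_ge0.
- exists (\int[mu]_u (M * f u)) => x.
  apply: le_Rintegral => //; first exact: nice_conv_integ.
    by apply: integZ => //; exact: nice_integ.
  by move=> u _; rewrite mulrC ler_wpM2r ?nice_ge0.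
- apply/integrableP; split.
    by apply/measurable_EFinP; apply: measurable_continuous; exact: continuous_conv.
  under eq_integral => y _.
    rewrite /= ger0_norm ?conv_ge0// EFin_Rintegral//; last exact: nice_conv_integ.
    over.
  rewrite -(@lebesgue_tonelli _ (fun z => (f z.1 * g (z.2 - z.1))%:E))//=.
  + by rewrite integral_conv_kernel// ltry.
  + by apply/measurable_EFinP; exact: measurable_conv_kernel.
  + by move=> z; rewrite lee_fin mulr_ge0 ?nice_ge0.
- by exists set0 => // x _; exact: continuous_conv.
Qed.

Lemma Rintegral_conv f g k : nice f -> nice g ->
  measurable_fun setT k -> (forall x, `|k x| <= 1) ->
  \int[mu]_y (conv f g y * k y) =
  \int[mu]_u (f u * \int[mu]_y (g y * k (y + u))).
Proof.
move=> nf ng mk k1.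
have ikg u : integ setT (fun y => g (y - u) * k y).
  apply: (@integ_mul_bounded _ _ _ _ 1) => //.
  exact: (integ_shift (- u) (nice_integ ng)).
transitivity (\int[mu]_y \int[mu]_u (f u * g (y - u) * k y)).
  apply: eq_Rintegral => y _; rewrite -RintegralZr//.
  exact: nice_conv_integ.
transitivity (\int[mu]_u \int[mu]_y (f u * g (y - u) * k y)); last first.
  apply: eq_Rintegral => u _.
  under eq_Rintegral do rewrite -mulrA.
  rewrite RintegralZl//; congr (_ * _).
  rewrite -(Rintegral_shift u (ikg u)); apply: eq_Rintegral => y _.
  by rewrite addrK.
symmetry; apply: (@Rfubini _ (fun z => f z.1 * g (z.2 - z.1) * k z.2)
  (fun z => f z.1 * g (z.2 - z.1))) => /=.
- apply: measurable_funM; first exact: measurable_conv_kernel.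
  by apply: measurableT_comp => //; exact: measurable_snd.
- exact: measurable_conv_kernel.
- by move=> z; rewrite normrM ger0_norm ?mulr_ge0 ?nice_ge0// ler_piMr ?mulr_ge0 ?nice_ge0.
- move=> u; under eq_fun do rewrite -mulrA.
  exact: integZ.
- move=> y; under eq_fun do rewrite mulrC.
  by apply: integZ => //; exact: nice_conv_integ.
- by rewrite integral_conv_kernel// ltry.
Qed.

Definition cosT g t : R := \int[mu]_x (g x * cos (t * x)).
Definition sinT g t : R := \int[mu]_x (g x * sin (t * x)).

(** The squared modulus of the Fourier transform [cosT g t - i sinT g t]. *)
Definition power_spectrum g t : R := cosT g t ^+ 2 + sinT g t ^+ 2.

Lemma measurable_cosM t : measurable_fun setT (fun x : R => cos (t * x)).
Proof. by apply: measurable_continuous; exact: continuous_cosM. Qed.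

Lemma measurable_sinM t : measurable_fun setT (fun x : R => sin (t * x)).
Proof. by apply: measurable_continuous; exact: continuous_sinM. Qed.

Lemma integ_cos g t : nice g -> integ setT (fun x => g x * cos (t * x)).
Proof.
move=> ng; apply: (@integ_mul_bounded _ _ _ _ 1) => //; first exact: nice_integ.
- exact: measurable_cosM.
- by move=> x _; exact: norm_cos_le1.
Qed.

Lemma integ_sin g t : nice g -> integ setT (fun x => g x * sin (t * x)).
Proof.
move=> ng; apply: (@integ_mul_bounded _ _ _ _ 1) => //; first exact: nice_integ.
- exact: measurable_sinM.
- by move=> x _; exact: norm_sin_le1.
Qed.

Lemma cosT_conv f g t : nice f -> nice g ->
  cosT (conv f g) t = cosT f t * cosT g t - sinT f t * sinT g t.
Proof.
move=> nf ng; rewrite {1}/cosT Rintegral_conv//; last 2 first.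
- exact: measurable_cosM.
- by move=> x; exact: norm_cos_le1.
transitivity (\int[mu]_u (cosT g t * (f u * cos (t * u)) +
                          - sinT g t * (f u * sin (t * u)))).
  apply: eq_Rintegral => u _.
  transitivity (f u * \int[mu]_y (cos (t * u) * (g y * cos (t * y)) +
                                  - sin (t * u) * (g y * sin (t * y)))).
    congr (_ * _); apply: eq_Rintegral => y _.
    by rewrite mulrDr cosD; ring.
  rewrite Rintegral_lincomb//; [by rewrite /cosT /sinT; ring| |].
    exact: integ_cos.
  exact: integ_sin.
rewrite Rintegral_lincomb//; [by rewrite /cosT /sinT; ring| |].
  exact: integ_cos.
exact: integ_sin.
Qed.

Lemma sinT_conv f g t : nice f -> nice g ->
  sinT (conv f g) t = sinT f t * cosT g t + cosT f t * sinT g t.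
Proof.
move=> nf ng; rewrite {1}/sinT Rintegral_conv//; last 2 first.
- exact: measurable_sinM.
- by move=> x; exact: norm_sin_le1.
transitivity (\int[mu]_u (cosT g t * (f u * sin (t * u)) +
                          sinT g t * (f u * cos (t * u)))).
  apply: eq_Rintegral => u _.
  transitivity (f u * \int[mu]_y (sin (t * u) * (g y * cos (t * y)) +
                                  cos (t * u) * (g y * sin (t * y)))).
    congr (_ * _); apply: eq_Rintegral => y _.
    by rewrite mulrDr sinD; ring.
  rewrite Rintegral_lincomb//; [by rewrite /cosT /sinT; ring| |].
    exact: integ_cos.
  exact: integ_sin.
rewrite Rintegral_lincomb//; [by rewrite /cosT /sinT; ring| |].
  exact: integ_sin.
exact: integ_cos.
Qed.

(** The Fourier transform of a convolution is the product of the transforms, and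
    the squared modulus is multiplicative. *)
Lemma power_spectrum_conv f g t : nice f -> nice g ->
  power_spectrum (conv f g) t = power_spectrum f t * power_spectrum g t.
Proof.
by move=> nf ng; rewrite /power_spectrum cosT_conv// sinT_conv//; ring.
Qed.

Lemma power_spectrum_ge0 g t : 0 <= power_spectrum g t.
Proof. by rewrite addr_ge0// sqr_ge0. Qed.

Lemma cosTN g t : cosT g (- t) = cosT g t.
Proof. by apply: eq_Rintegral => x _; rewrite mulNr cosN. Qed.

Lemma cosT_reflect g t : nice g -> cosT (fun x => g (- x)) t = cosT g t.
Proof.
move=> ng; rewrite /cosT -[RHS]Rintegral_opp; last exact: integ_cos.
by apply: eq_Rintegral => x _; rewrite mulrN cosN.
Qed.

Lemma sinT_reflect g t : nice g -> sinT (fun x => g (- x)) t = - sinT g t.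
Proof.
move=> ng; rewrite /sinT -[X in - X]Rintegral_opp; last exact: integ_sin.
rewrite -mulN1r -RintegralZl//; last exact: (integ_opp (integ_sin t ng)).
by apply: eq_Rintegral => x _; rewrite mulrN sinN; ring.
Qed.

(** Its Fourier transform is the product of that of [g] with its conjugate, which
    is [power_spectrum g], and its value at [0] is the integral of [g ^+ 2]:
    inverting the transform at [0] is Plancherel's identity for [g]. *)
Definition autocorrelation g := conv g (fun x => g (- x)).

Lemma cosT_autocorrelation g t : nice g ->
  cosT (autocorrelation g) t = power_spectrum g t.
Proof.
move=> ng; rewrite cosT_conv ?cosT_reflect ?sinT_reflect//.
  by rewrite /power_spectrum; ring.
exact: nice_reflect.
Qed.

Lemma autocorrelation0 g : autocorrelation g 0 = \int[mu]_x (g x ^+ 2).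
Proof.
by apply: eq_Rintegral => x _; rewrite sub0r opprK.
Qed.

Lemma nice_autocorrelation g : nice g -> nice (autocorrelation g).
Proof. by move=> ng; apply: nice_conv => //; exact: nice_reflect. Qed.

Lemma continuous_cosT g : nice g -> continuous (cosT g).
Proof.
move=> ng t; apply/continuous_withinNx/cvgr_dnbhsP => w [_ wt].
apply: (@Rdominated_cvg _ _ _ _ g) => //.
- by move=> n; apply: integ_measurable; exact: integ_cos.
- by apply: integ_measurable; exact: integ_cos.
- apply: aeW => x _; apply: cvgMr.
  apply: (@cvg_comp _ _ _ (fun n => w n * x) cos _ (nbhs (t * x))).
    exact: cvgMl.
  exact: continuous_cos.
- exact: nice_integ.
- by move=> n x _; rewrite normrM ger0_norm ?nice_ge0// ler_piMr ?norm_cos_le1 ?nice_ge0.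
Qed.

End fourier.

(** * Plancherel's formula *)

Section plancherel.
Context {R : realType}.
Local Notation mu := (@lebesgue_measure R).
Local Notation integ D f := (mu.-integrable D (EFin \o f)).
Implicit Types (f g h : R -> R) (e t x y z : R).

Lemma oneDsqr_pos x : 0 < oneDsqr x.
Proof. exact: lt_le_trans (oneDsqr_ge1 x). Qed.

Lemma integral_oneDsqrV : (\int[mu]_x ((oneDsqr x)^-1)%:E = (@pi R)%:E)%E.
Proof.
rewrite ge0_symfun_integralT.
- rewrite -set_itvcy integral0y_oneDsqr -EFinM; congr EFin.
  by rewrite mulrC divfK.
- by move=> x; rewrite invr_ge0 (ltW (oneDsqr_pos x)).
- exact: continuous_oneDsqrV.
- by move=> x; rewrite /= /oneDsqr sqrrN.
Qed.

Lemma integ_oneDsqrV : integ setT (fun x => (oneDsqr x)^-1).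
Proof.
apply/integrableP; split.
  by apply/measurable_EFinP; apply: measurable_continuous; exact: continuous_oneDsqrV.
under eq_integral => x _ do rewrite /= ger0_norm ?invr_ge0 ?(ltW (oneDsqr_pos x))//.
by rewrite integral_oneDsqrV ltry.
Qed.

(** Abel summation of the inversion integral produces the Poisson kernel of the
    half-plane, as the Laplace transform of the cosine. *)
Lemma abel_cosT h e : nice h -> 0 < e ->
  \int[mu]_(t in `[0, +oo[) (expR (- e * t) * cosT h t) =
  \int[mu]_z (h z * (e / (e ^+ 2 + z ^+ 2))).
Proof.
move=> nh e0.
pose E := (fun t => expR (- e * t)) \_ `[0, +oo[%classic.
have E0 t : 0 <= E t.
  by rewrite /E patchE; case: ifP => // _; exact: expR_ge0.
have iE : integ setT E.
  have := integ_expRNM e0; rewrite integrable_mkcond//.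
  by rewrite restrict_EFin.
have mE := integ_measurable iE; have mh := nice_measurable nh.
have iEcos z : integ setT (fun t => E t * cos (t * z)).
  under eq_fun => t do rewrite [t * z]mulrC.
  apply: (@integ_mul_bounded _ _ _ _ 1) => //; first exact: measurable_cosM.
  by move=> x _; exact: norm_cos_le1.
transitivity (\int[mu]_t \int[mu]_z (E t * h z * cos (t * z))).
  rewrite Rintegral_mkcond; apply: eq_Rintegral => t _.
  under [RHS]eq_Rintegral do rewrite -mulrA.
  rewrite RintegralZl//; last exact: integ_cos.
  by rewrite /E !patchE; case: ifPn => _; rewrite ?mul0r.
transitivity (\int[mu]_z \int[mu]_t (E t * h z * cos (t * z))).
  apply: (@Rfubini _ (fun w => E w.1 * h w.2 * cos (w.1 * w.2))
    (fun w => E w.1 * h w.2)) => /=.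
  - apply: measurable_funM.
      by apply: measurable_funM; apply: measurableT_comp.
    apply: measurableT_comp => //; last exact: measurable_funM.
    by apply: measurable_continuous; exact: continuous_cos.
  - by apply: measurable_funM; apply: measurableT_comp.
  - move=> w; have w0 : 0 <= E w.1 * h w.2.
      by apply: mulr_ge0 => //; exact: nice_ge0.
    by rewrite normrM ger0_norm// ler_piMr// norm_cos_le1.
  - move=> t; under eq_fun do rewrite -mulrA.
    by apply: integZ => //; exact: integ_cos.
  - move=> z; under eq_fun do rewrite mulrAC mulrC.
    exact: integZ.
  - under eq_integral => t _.
      rewrite -EFin_Rintegral//; last by apply: integZ => //; exact: nice_integ.
      rewrite RintegralZl//; last exact: nice_integ.
      rewrite mulrC; over.
    rewrite -EFin_Rintegral ?ltry//; exact: integZ.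
apply: eq_Rintegral => z _.
transitivity (\int[mu]_t (h z * (E t * cos (t * z)))).
  by apply: eq_Rintegral => t _; ring.
rewrite RintegralZl//.
congr (_ * _); rewrite -Rintegral_expRN_cos// [RHS]Rintegral_mkcond.
apply: eq_Rintegral => t _; rewrite /E !patchE [t * z]mulrC.
by case: ifPn => _; rewrite ?mul0r.
Qed.

Lemma poisson_kernel_scale h e : nice h -> continuous h -> 0 < e ->
  \int[mu]_z (h z * (e / (e ^+ 2 + z ^+ 2))) =
  \int[mu]_z (h (e * z) * (oneDsqr z)^-1).
Proof.
move=> nh ch e0; congr fine.
have d0 z : 0 < e ^+ 2 + z ^+ 2 by exact: sumsqr_gt0.
have dE : derive1 ( *%R e) = cst e.
  by apply/funext => x; rewrite derive1E derive_val /GRing.scale/= mulr1.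
rewrite (@increasing_ge0_integration_by_substitutionT _ ( *%R e)) => //.
- apply: eq_integral => z _; rewrite dE /= mulrfctE /=; congr EFin.
  have z0 := oneDsqr_pos z; have := d0 (e * z); rewrite /oneDsqr in z0 * => ez0.
  by field; rewrite ?gt_eqF.
- by move=> x y xy; rewrite ltr_pM2l.
- by rewrite dE; move=> x; exact: cvg_cst.
- by rewrite dE; exact: is_cvg_cst.
- by rewrite dE; exact: is_cvg_cst.
- exact: gt0_cvgMrNy.
- exact: gt0_cvgMry.
- move=> z; apply: cvgM; first exact: ch.
  apply: cvgMr; apply: cvgV; first by rewrite gt_eqF.
  by apply: cvgD; [exact: cvg_cst|exact: exprn_continuous].
- move=> z; have z0 := d0 z.
  by apply: mulr_ge0; [exact: nice_ge0|rewrite divr_ge0// ltW].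
Qed.

Lemma abel_cosT_cvg h : nice h -> continuous h ->
  \int[mu]_(t in `[0, +oo[) (expR (- n.+1%:R^-1 * t) * cosT h t) @[n --> \oo]
    --> h 0 * pi.
Proof.
move=> nh ch; have [M hM] := nice_bounded nh.
have -> : h 0 * pi = \int[mu]_z (h 0 * (oneDsqr z)^-1).
  rewrite RintegralZl//; last exact: integ_oneDsqrV.
  by rewrite /Rintegral integral_oneDsqrV.
under eq_fun => n.
  rewrite abel_cosT ?invr_gt0// poisson_kernel_scale ?invr_gt0//; over.
have mV := integ_measurable integ_oneDsqrV.
have mh := nice_measurable nh.
apply: (@Rdominated_cvg _ _ _ _ (fun z => M * (oneDsqr z)^-1)) => //.
- move=> n; apply: measurable_funM => //; apply: measurableT_comp => //.
- exact: measurable_funM.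
- apply: aeW => z _; apply: cvgMl.
  apply: (@cvg_comp _ _ _ (fun n : nat => n.+1%:R^-1 * z) h _ (nbhs (0 : R))).
    by rewrite -[0](mul0r z); apply: cvgMl; exact: cvg_harmonic.
  exact: ch.
- by apply: integZ => //; exact: integ_oneDsqrV.
- move=> n z _; have z0 := oneDsqr_pos z.
  by rewrite ger0_norm ?mulr_ge0 ?invr_ge0 ?(ltW z0) ?nice_ge0// ler_wpM2r ?invr_ge0 ?(ltW z0).
Qed.

Lemma norm_cosT_le h t : nice h -> `|cosT h t| <= \int[mu]_x h x.
Proof.
move=> nh; apply: le_trans (le_normr_Rintegral _ (integ_cos t nh)) _ => //.
apply: le_Rintegral => //; first exact: (integrable_norm (integ_cos t nh)).
  exact: nice_integ.
by move=> x _; rewrite normrM ger0_norm ?nice_ge0// ler_piMr ?nice_ge0 ?norm_cos_le1.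
Qed.

(** As [e] tends to [0], the Abel means increase to the integral of [cosT h] over
    the half-line because [cosT h] is nonnegative, while the Poisson kernel
    concentrates at [0]. Integrability of [cosT h] is part of the conclusion. *)
Lemma fourier_inversion0 h : nice h -> continuous h ->
  (forall t, 0 <= cosT h t) ->
  (\int[mu]_t (cosT h t)%:E = (2 * pi * h 0)%:E)%E.
Proof.
move=> nh ch H0; have cH := continuous_cosT nh.
have mH := measurable_continuous cH.
rewrite ge0_symfun_integralT//; last by move=> t; rewrite /= cosTN.
rewrite -set_itvcy -mulrA EFinM; congr (_ * _)%E; rewrite [pi * _]mulrC.
pose u (n : nat) t := expR (- n.+1%:R^-1 * t) * cosT h t.
have mu_ n : measurable_fun setT (u n).
  apply: measurable_funM => //; apply: measurable_continuous.
  exact: continuous_expRM.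
have u0 n t : 0 <= u n t by rewrite mulr_ge0 ?expR_ge0.
have iu n : integ `[0, +oo[ (u n).
  apply: (@integ_expRNM_bounded _ n.+1%:R^-1 _ (\int[mu]_x h x)) => //.
  by move=> t; exact: norm_cosT_le.
have lu : (\int[mu]_(t in `[0%R, +oo[) (u n t)%:E)%E @[n --> \oo] --> (h 0 * pi)%:E.
  under eq_fun do rewrite -EFin_Rintegral//.
  by apply: cvg_EFin; [exact: nearW|exact: abel_cosT_cvg].
have uH t : u n t @[n --> \oo] --> cosT h t.
  rewrite -[cosT h t]mul1r -expR0; apply: cvgMl.
  apply: (@cvg_comp _ _ _ (fun n : nat => - n.+1%:R^-1 * t) expR _ (nbhs (0 : R))).
    rewrite -[0](mul0r t) -oppr0; apply: cvgMl; apply: cvgN; exact: cvg_harmonic.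
  exact: continuous_expR.
have uE t : limn (EFin \o u ^~ t) = (cosT h t)%:E.
  by apply/cvg_lim => //; apply: cvg_EFin (uH t); exact: nearW.
have -> : (\int[mu]_(t in `[0%R, +oo[) (cosT h t)%:E =
    \int[mu]_(t in `[0%R, +oo[) limn (EFin \o u ^~ t))%E.
  by apply: eq_integral => t _; rewrite uE.
apply: (cvg_unique _ _ lu) => //.
apply: cvg_monotone_convergence => //.
- by move=> n; apply/measurable_EFinP; exact: (integ_measurable (iu n)).
- by move=> n t _; rewrite lee_fin.
- move=> t; rewrite /= in_itv/= andbT => t0 m n mn; rewrite lee_fin ler_wpM2r//.
  by rewrite ler_expR ler_wpM2r// lerN2 lef_pV2 ?posrE// ler_nat.
Qed.

Theorem plancherel g : nice g ->
  (\int[mu]_t (power_spectrum g t)%:E = (2 * pi * \int[mu]_x (g x ^+ 2))%:E)%E.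
Proof.
move=> ng; rewrite -autocorrelation0.
under eq_integral do rewrite -cosT_autocorrelation//.
apply: fourier_inversion0.
- exact: nice_autocorrelation.
- by apply: continuous_conv => //; exact: nice_reflect.
- by move=> t; rewrite cosT_autocorrelation// power_spectrum_ge0.
Qed.

End plancherel.

(** * Real-analytic functions and Laplace transforms *)

Section real_analytic.
Context {R : realType}.
Implicit Types (f g : R -> R) (a b : nat -> R) (c r x y : R).

(** The real and imaginary parts of a holomorphic function on a horizontal line
    are power series of this real form, which is all that the continuation of
    zeta requires. *)
Definition real_analytic_at f x0 := exists a r, 0 < r /\
  forall x, `|x - x0| < r ->
    series (fun k => a k * (x - x0) ^+ k) @ \oo --> f x.

Lemma real_analyticD f g x0 : real_analytic_at f x0 -> real_analytic_at g x0 ->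
  real_analytic_at (fun x => f x + g x) x0.
Proof.
move=> [a [r [r0 af]]] [b [s [s0 bg]]].
exists (fun k => a k + b k), (Num.min r s); split; first by rewrite lt_min r0.
move=> x; rewrite lt_min => /andP[/af fx /bg gx].
rewrite (_ : series _ = fun n => series (fun k => a k * (x - x0) ^+ k) n +
                        series (fun k => b k * (x - x0) ^+ k) n); first exact: cvgD.
apply/funext => n; rewrite /series /= -big_split.
by apply: eq_bigr => k _; rewrite mulrDl.
Qed.

Lemma real_analyticZ c f x0 : real_analytic_at f x0 ->
  real_analytic_at (fun x => c * f x) x0.
Proof.
move=> [a [r [r0 af]]]; exists (fun k => c * a k), r; split => // x /af fx.
rewrite (_ : series _ = fun n => c * series (fun k => a k * (x - x0) ^+ k) n).
  exact: cvgMr.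
apply/funext => n; rewrite /series /= mulr_sumr.
by apply: eq_bigr => k _; rewrite mulrA.
Qed.

Lemma real_analytic_cst c x0 : real_analytic_at (fun=> c) x0.
Proof.
exists (fun k => c *+ (k == 0%N)), 1; split => // x _.
apply: cvg_near_cst; exists 1%N => // -[//|n] _ /=; rewrite /series /= big_nat_recl//= big1 ?addr0.
  by rewrite expr0 mulr1.
by move=> k _; rewrite mul0r.
Unshelve. all: by end_near. Qed.

Lemma real_analyticMid f x0 : real_analytic_at f x0 ->
  real_analytic_at (fun x => x * f x) x0.
Proof.
move=> [a [r [r0 af]]].
exists (fun k => x0 * a k + (if k is j.+1 then a j else 0)), r; split => // x /af fx.
have -> : x * f x = x0 * f x + (x - x0) * f x by ring.
rewrite -(cvg_shiftS (series _)) /=.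
rewrite (_ : (fun n => series _ n.+1) = fun n =>
    x0 * series (fun k => a k * (x - x0) ^+ k) n.+1 +
    (x - x0) * series (fun k => a k * (x - x0) ^+ k) n).
  apply: cvgD; apply: cvgMr => //.
  by rewrite (cvg_shiftS (series (fun k => a k * (x - x0) ^+ k))).
apply/funext => n; rewrite /series /= !mulr_sumr.
under eq_bigr do rewrite mulrDl.
rewrite big_split /=; congr (_ + _).
  by apply: eq_bigr => k _; rewrite mulrA.
rewrite big_nat_recl// mul0r add0r.
by apply: eq_bigr => k _; rewrite exprS; ring.
Qed.

Lemma geometric_sum_le2 (q : R) n : 0 <= q -> q <= 2^-1 ->
  \sum_(0 <= k < n) q ^+ k <= 2.
Proof.
move=> q0 q2; elim: n => [|n IHn]; first by rewrite big_nil.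
rewrite big_nat_recl// expr0.
under eq_bigr do rewrite exprS.
rewrite -mulr_sumr.
have : q * \sum_(0 <= k < n) q ^+ k <= 2^-1 * 2.
  by apply: ler_pM => //; apply: sumr_ge0 => k _; rewrite exprn_ge0.
rewrite mulVf//; lra.
Qed.

(** The terms at [h0 = r / 2] are bounded by some [M], so for [h <= h0 / 2] the
    tail of the series is at most [2 * M * (h / h0)]; since the sum vanishes,
    so does [a 0] in the limit. *)
Lemma pseries_eq0_head a r : 0 < r ->
  (forall h, 0 < h -> h < r -> series (fun k => a k * h ^+ k) @ \oo --> (0 : R)) ->
  a 0%N = 0.
Proof.
move=> r0 a0.
pose h0 := r / 2.
have h00 : 0 < h0 by rewrite divr_gt0.
have [M M0 aM] : exists2 M, 0 < M & forall k, `|a k| * h0 ^+ k <= M.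
  have h0r : h0 < r by rewrite /h0; lra.
  have := cvg_series_cvg_0 (cvgP _ (a0 _ h00 h0r)).
  move=> /cvgP /cvg_seq_bounded [M [Mreal HM]].
  exists (`|M| + 1); first by rewrite ltr_wpDl.
  move=> k; have := HM (`|M| + 1) _ k Logic.I.
  rewrite /= normrM [`|h0 ^+ k|]ger0_norm ?exprn_ge0 ?(ltW h00)// => H; apply: H.
  by rewrite (le_lt_trans (ler_norm M))// ltrDl.
have bound h : 0 < h -> h <= h0 / 2 -> `|a 0%N| <= 2 * M * (h / h0).
  move=> hp hh; set q := h / h0.
  have q0 : 0 <= q by rewrite divr_ge0// ltW.
  have q2 : q <= 2^-1 by rewrite ler_pdivrMr// mulrC.
  have hr : h < r by move: hh; rewrite /h0; lra.
  have Sb n : `|series (fun k => a k * h ^+ k) n.+1 - a 0%N| <= 2 * M * q.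
    rewrite /series /= big_nat_recl// expr0 mulr1 addrAC subrr add0r.
    apply: le_trans (ler_norm_sum _ _ _) _.
    apply: (@le_trans _ _ (\sum_(0 <= k < n) (M * q) * q ^+ k)).
      apply: ler_sum => k _.
      rewrite -mulrA -exprS /q expr_div_n normrM [`|h ^+ _|]ger0_norm ?exprn_ge0 ?(ltW hp)//.
      rewrite [h ^+ _ / _]mulrC mulrA ler_wpM2r ?exprn_ge0 ?(ltW hp)//.
      by rewrite ler_pdivlMr ?exprn_gt0.
    rewrite -mulr_sumr [M * q * _]mulrC -[X in _ <= X]mulrA.
    rewrite ler_wpM2r ?(mulr_ge0 (ltW M0) q0)//.
    exact: geometric_sum_le2.
  have := a0 h hp hr; rewrite -(cvg_shiftS (series _)) => cv.
  have cv' : `|series (fun k => a k * h ^+ k) n.+1 - a 0%N| @[n --> \oo] --> `|0 - a 0%N|.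
    by apply: cvg_norm; apply: cvgB => //; exact: cvg_cst.
  rewrite -normrN -sub0r.
  by apply: (cvgr_to_le cv'); exact: nearW.
apply/eqP/negP => /negP; rewrite -normr_gt0 => a00.
(* The second bound makes the estimate at [h] at most half of [`|a 0%N|]. *)
pose h := Num.min (h0 / 2) (`|a 0%N| * h0 / (4 * M)).
have hp : 0 < h by rewrite lt_min !divr_gt0// ?mulr_gt0.
have := bound h hp; rewrite ge_min lexx => /(_ isT).
apply/negP; rewrite -ltNge.
apply: (@le_lt_trans _ _ (2 * M * ((`|a 0%N| * h0 / (4 * M)) / h0))).
  by rewrite ler_wpM2l ?mulr_ge0 ?(ltW M0)// ler_pM2r ?invr_gt0// ge_min lexx orbT.
have -> : 2 * M * (`|a 0%N| * h0 / (4 * M) / h0) = `|a 0%N| / 2.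
  by field; rewrite !gt_eqF.
by rewrite ltr_pdivrMr// ltr_pMr//; lra.
Qed.

Lemma pseries_eq0 a r : 0 < r ->
  (forall h, 0 < h -> h < r -> series (fun k => a k * h ^+ k) @ \oo --> (0 : R)) ->
  forall n, a n = 0.
Proof.
move=> r0 ar n; elim: n a ar => [|n IHn] a ar; first exact: (pseries_eq0_head r0).
apply: (IHn (fun k => a k.+1)) => h h0 hr.
have a0 := pseries_eq0_head r0 ar.
have := ar _ h0 hr; rewrite -(cvg_shiftS (series _)) /= => cv.
rewrite (_ : series _ = fun n => h^-1 * series (fun k => a k * h ^+ k) n.+1).
  by rewrite -[0](mulr0 h^-1); exact: cvgMr.
apply/funext => m; rewrite /series /= big_nat_recl// a0 mul0r add0r mulr_sumr.
by apply: eq_bigr => k _; rewrite exprS; field; rewrite gt_eqF.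
Qed.

(** The infimum of the [a > 0] such that [f] vanishes beyond [a] cannot be
    positive, since the power series of [f] at that point would be zero. *)
Lemma real_analytic_identity f : (forall x, 0 < x -> real_analytic_at f x) ->
  (forall x, 1 < x -> f x = 0) -> forall x, 0 < x -> f x = 0.
Proof.
move=> af f1 y y0; apply: contrapT => fy.
pose A := [set a | 0 < a /\ forall x, a < x -> f x = 0].
have A1 : A 1 by split.
have lbA : lbound A y.
  move=> a [_ fa]; rewrite leNgt; apply/negP => /fa; exact: fy.
have infA : has_inf A by split; [exists 1|exists y].
set b := inf A; have yb : y <= b by apply: lb_le_inf => //; exists 1.
have b0 : 0 < b by exact: lt_le_trans yb.
have fb x : b < x -> f x = 0.
  move=> bx; have [a [_ fa] ax] := inf_lt (ex_intro _ 1 A1) bx.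
  exact: fa.
have [a [r [r0 ar]]] := af _ b0.
have az : forall n, a n = 0.
  apply: (pseries_eq0 r0) => h h0 hr.
  have := ar (b + h); rewrite addrAC subrr add0r (gtr0_norm h0) => /(_ hr).
  by rewrite fb ?ltrDl.
pose c := Num.max (b - r) (b / 2).
have cb : c < b by rewrite gt_max ltrBlDr ltrDl r0 ltr_pdivrMr// ltr_pMr//; lra.
have : A c.
  split; first by rewrite lt_max divr_gt0 ?orbT.
  move=> x cx; have [xb|xb] := ltP b x; first exact: fb.
  have xr : `|x - b| < r.
    rewrite ler0_norm ?subr_le0//.
    by move: cx; rewrite gt_max => /andP[? _]; lra.
  have := ar _ xr; rewrite (_ : series _ = cst 0).
    by move=> /(cvg_lim _) <- //; exact: lim_cst.
  by apply/funext => n; rewrite /series /= big1// => k _; rewrite az mul0r.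
move=> Ac; have : b <= c by apply: ge_inf => //; case: infA.
by rewrite leNgt cb.
Qed.

End real_analytic.

Section laplace_analytic.
Context {R : realType}.
Local Notation mu := (@lebesgue_measure R).
Local Notation integ D f := (mu.-integrable D (EFin \o f)).
Implicit Types (m : R -> R) (x y h : R).

Definition laplace m x : R :=
  \int[mu]_(y in `[0, +oo[) (m y * expR (- x * y)).

Lemma series_exp_coeff_le x n : 0 <= x -> series (exp_coeff x) n <= expR x.
Proof.
move=> x0; apply: nondecreasing_cvgn_le; last exact: is_cvg_series_exp_coeff.
by apply: nondecreasing_series => k _ _; exact: exp_coeff_ge0.
Qed.

Lemma norm_exp_coeff x n : `|exp_coeff x n| = exp_coeff `|x| n.
Proof. by rewrite !exp_coeffE/= normrM normrX ger0_norm// invr_ge0. Qed.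

Lemma norm_series_exp_coeff_le x n : `|series (exp_coeff x) n| <= expR `|x|.
Proof.
apply: le_trans (series_exp_coeff_le n (normr_ge0 x)).
rewrite /series /=; apply: le_trans (ler_norm_sum _ _ _) _.
by apply: ler_sum => k _; rewrite norm_exp_coeff.
Qed.

Lemma norm_exp_coeff_le x n : `|exp_coeff x n| <= expR `|x|.
Proof.
rewrite norm_exp_coeff.
apply: le_trans (series_exp_coeff_le n.+1 (normr_ge0 x)).
by rewrite seriesSr /= lerDr; apply: sumr_ge0 => k _; exact: exp_coeff_ge0.
Qed.

(** Expand [expR (- h * y)] under the integral sign; the partial sums are
    dominated by [expR (`|h| * y)]. *)
Lemma laplace_analytic m (M : R) x0 : measurable_fun setT m ->
  (forall y, `|m y| <= M) -> 0 < x0 -> real_analytic_at (laplace m) x0.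
Proof.
move=> mm mM x00.
have M0 : 0 <= M by exact: le_trans (mM 0).
pose c k y := m y * expR (- x0 * y) * exp_coeff (- y) k.
have coeffM h y k : exp_coeff (- y) k * h ^+ k = exp_coeff (- h * y) k.
  by rewrite !exp_coeffE/= -mulrA -exprMn; congr (_ * _ ^+ _); ring.
have mexp k h : measurable_fun setT (fun y => exp_coeff (- h * y) k).
  under eq_fun do rewrite exp_coeffE /=.
  apply: measurable_funM => //.
  by apply: measurable_funX; apply: measurable_funM => //; exact: measurable_id.
have mE x : measurable_fun setT (fun y : R => expR (- x * y)).
  by apply: measurable_continuous; exact: continuous_expRM.
have dom h : `|h| < x0 ->
    integ `[0, +oo[ (fun y => M * expR (- (x0 - `|h|) * y)).
  by move=> hx; apply: integZ => //; apply: integ_expRNM; rewrite subr_gt0.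
have domE h y : 0 <= y ->
    M * expR (- (x0 - `|h|) * y) = M * expR (- x0 * y) * expR `|- h * y|.
  move=> y0; rewrite -mulrA -expRD normrM normrN [`|y|]ger0_norm//.
  by congr (_ * expR _); ring.
have ic h k : `|h| < x0 -> integ `[0, +oo[ (fun y => c k y * h ^+ k).
  move=> hx; apply: (integ_le _ _ (dom h hx)) => //.
    apply: measurable_funTS; rewrite /c; under eq_fun do rewrite -mulrA coeffM.
    by apply: measurable_funM => //; exact: measurable_funM.
  move=> y /=; rewrite in_itv/= andbT => y0; rewrite domE// /c -mulrA coeffM.
  rewrite normrM [`|m y * _|]normrM [`|expR _|]ger0_norm ?expR_ge0//.
  by rewrite ler_pM ?mulr_ge0 ?expR_ge0// ?ler_pM ?expR_ge0// ?norm_exp_coeff_le.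
(* At the nonzero point [h = x0 / 2] the factor [h ^+ k] can be divided out. *)
have ick k : integ `[0, +oo[ (c k).
  have hx : `|x0 / 2| < x0.
    by rewrite gtr0_norm ?divr_gt0// ltr_pdivrMr// ltr_pMr//; lra.
  have := integZ ((x0 / 2) ^+ k)^-1 _ (ic (x0 / 2) k hx).
  rewrite (_ : (fun y => _) = c k); first exact.
  apply/funext => y; rewrite mulrCA mulVf ?mulr1// expf_neq0// gt_eqF// divr_gt0//.
exists (fun k => \int[mu]_(y in `[0, +oo[) c k y), x0; split => // x xr.
set h := x - x0 in xr *.
pose u n y := m y * expR (- x0 * y) * series (exp_coeff (- h * y)) n.
rewrite (_ : series _ = fun n => \int[mu]_(y in `[0, +oo[) u n y); last first.
  apply/funext => n; rewrite /series /=.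
  suff [] : integ `[0, +oo[ (u n) /\
      \sum_(0 <= k < n) (\int[mu]_(y in `[0, +oo[) c k y) * h ^+ k =
      \int[mu]_(y in `[0, +oo[) u n y by [].
  elim: n => [|n [iu IHn]].
    have u0 : u 0%N = cst 0.
      by apply/funext => y; rewrite /u /series/= big_nil mulr0.
    rewrite big_nil u0; split; first exact: integrable0.
    by rewrite Rintegral_cst// mul0r.
  have uS : u n.+1 = fun y => u n y + c n y * h ^+ n.
    by apply/funext => y; rewrite /u /c seriesSr mulrDr -[X in _ = _ + X]mulrA coeffM.
  rewrite big_nat_recr//= IHn uS; split; first by apply: integD => //; exact: ic.
  rewrite RintegralD//; last exact: ic.
  by rewrite RintegralZr.
have -> : laplace m x = \int[mu]_(y in `[0, +oo[) (m y * expR (- x0 * y) * expR (- h * y)).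
  apply: eq_Rintegral => y _; rewrite -mulrA -expRD; congr (_ * expR _).
  by rewrite /h; ring.
apply: (@Rdominated_cvg _ _ _ _ (fun y => M * expR (- (x0 - `|h|) * y))) => //.
- move=> n; apply: measurable_funTS; apply: measurable_funM.
    exact: measurable_funM.
  by rewrite /series /=; apply: measurable_sum => k; exact: mexp.
- by apply: measurable_funTS; do ! apply: measurable_funM => //.
- by apply: aeW => y _; apply: cvgMr; exact: is_cvg_series_exp_coeff.
- exact: dom.
- move=> n y /=; rewrite in_itv/= andbT => y0; rewrite domE// /u.
  rewrite normrM [`|m y * _|]normrM [`|expR _|]ger0_norm ?expR_ge0//.
  by rewrite ler_pM ?mulr_ge0 ?expR_ge0// ?ler_pM ?expR_ge0// ?norm_series_exp_coeff_le.
Qed.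

End laplace_analytic.

(** * Real and imaginary parts of complex power series *)

Section complex_series.
Context {R : realType}.
Local Open Scope complex_scope.
Implicit Types (u : nat -> R[i]) (f zeta : R[i] -> R[i]) (z l : R[i]) (x t : R).

Lemma cvg_Re u l : u @ \oo --> (l : R[i]^o) ->
  (fun n => complex.Re (u n)) @ \oo --> complex.Re l.
Proof.
move=> /(@cvgrPdist_lt _ R[i]^o) ul; apply/cvgrPdist_lt => e e0.
have /ul : 0 < e%:C by rewrite ltcR.
apply: filterS => n; rewrite -raddfB /= -ltcR; apply: le_lt_trans.
exact: normc_ge_Re.
Qed.

Lemma cvg_Im u l : u @ \oo --> (l : R[i]^o) ->
  (fun n => complex.Im (u n)) @ \oo --> complex.Im l.
Proof.
move=> /(@cvgrPdist_lt _ R[i]^o) ul; apply/cvgrPdist_lt => e e0.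
have /ul : 0 < e%:C by rewrite ltcR.
apply: filterS => n; rewrite -raddfB /= -ltcR; apply: le_lt_trans.
by rewrite normc_def lecR -sqrtr_sqr ler_wsqrtr// lerDr sqr_ge0.
Qed.

Lemma ReMr z x : complex.Re (z * x%:C) = complex.Re z * x.
Proof. by case: z => a b /=; rewrite mulr0 subr0. Qed.

Lemma ImMr z x : complex.Im (z * x%:C) = complex.Im z * x.
Proof. by case: z => a b /=; rewrite mulr0 add0r. Qed.

Lemma analytic_at_real_line f x0 t : analytic_at f (x0 +i* t) ->
  real_analytic_at (fun x => complex.Re (f (x +i* t))) x0 /\
  real_analytic_at (fun x => complex.Im (f (x +i* t))) x0.
Proof.
move=> [a [r [r0 af]]].
have zE x : (x +i* t) - (x0 +i* t) = (x - x0)%:C.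
  by apply/eqP; rewrite eq_complex /= subrr !eqxx.
have fx x : `|x - x0| < r ->
    series (fun k => a k * ((x - x0) ^+ k)%:C) @ \oo --> (f (x +i* t) : R[i]^o).
  move=> xr; have := af (x +i* t); rewrite zE.
  rewrite /cmod /= expr0n/= addr0 sqrtr_sqr => /(_ xr).
  rewrite (_ : (fun k => a k * _) = (fun k => a k * ((x - x0) ^+ k)%:C)) //.
  by apply/funext => k; rewrite rmorphXn.
split.
- exists (fun k => complex.Re (a k)), r; split => // x /fx /cvg_Re.
  rewrite (_ : (fun n => complex.Re _) = series (fun k => complex.Re (a k) * (x - x0) ^+ k))//.
  apply/funext => n; rewrite /series /= raddf_sum; apply: eq_bigr => k _.
  exact: ReMr.
- exists (fun k => complex.Im (a k)), r; split => // x /fx /cvg_Im.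
  rewrite (_ : (fun n => complex.Im _) = series (fun k => complex.Im (a k) * (x - x0) ^+ k))//.
  apply/funext => n; rewrite /series /= raddf_sum; apply: eq_bigr => k _.
  exact: ImMr.
Qed.

Lemma natpowNE (k : nat) x t :
  natpowN k (x +i* t) =
    (expR (- x * ln k%:R) * cos (t * ln k%:R)) +i*
    (- (expR (- x * ln k%:R) * sin (t * ln k%:R))).
Proof.
rewrite /natpowN /cexp /=.
rewrite !mulr0 subr0 add0r !mulNr cosN sinN.
by apply/eqP; rewrite eq_complex /= !mul0r subr0 addr0 mulrN !eqxx.
Qed.

End complex_series.

(** * Dirichlet series as integrals *)

Section dirichlet.
Context {R : realType}.
Local Notation mu := (@lebesgue_measure R).
Local Notation integ D f := (mu.-integrable D (EFin \o f)).
Implicit Types (w W : R -> R) (x t y : R).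

Definition floor_exp y : R := (Num.truncn (expR y))%:R.

Lemma floor_exp_le y : floor_exp y <= expR y.
Proof. by rewrite truncn_le// expR_ge0. Qed.

Lemma ln_le_floor_exp k y : (ln k.+1%:R <= y) = (k < Num.truncn (expR y))%N.
Proof. by rewrite truncn_gt_nat -{2}[k.+1%:R]lnK ?posrE// ler_expR. Qed.

Let step (n : nat) (y : R) : R := \sum_(0 <= k < n) (ln (k.+1%:R : R) <= y)%R%:R.

Let stepE n y : step n y = (minn n (Num.truncn (expR y)))%:R.
Proof.
elim: n => [|n IHn]; first by rewrite /step big_nil min0n.
rewrite /step big_nat_recr//= -/(step n y) IHn ln_le_floor_exp -natrD.
congr (_%:R); case: ltnP => nm.
  by rewrite (minn_idPl nm) addn1.
by rewrite (minn_idPr (leqW nm)) addn0.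
Qed.

Let step_cvg y : step n y @[n --> \oo] --> floor_exp y.
Proof.
apply: cvg_near_cst; near=> n; rewrite stepE (minn_idPr _)//.
near: n; exact: nbhs_infty_ge.
Unshelve. all: by end_near. Qed.

Let measurable_step n : measurable_fun setT (step n).
Proof.
apply: measurable_sum => k.
rewrite (_ : (fun x => _) = \1_(`[ln k.+1%:R, +oo[ : set R)).
  exact: measurable_indic.
by apply/funext => y; rewrite indicE mem_setE in_itv/= andbT.
Qed.

Lemma measurable_floor_exp : measurable_fun setT floor_exp.
Proof.
apply: (measurable_fun_cvg measurable_step) => y _; exact: step_cvg.
Qed.

Lemma fracpart_expRE y : fracpart (expR y) = expR y - floor_exp y.
Proof.
rewrite /fracpart /floor_exp truncn_floor expR_ge0.
by rewrite natr_absz ger0_norm// floor_ge0 expR_ge0.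
Qed.

(** Each term [W (ln k.+1)] is the integral of [w] from [ln k.+1] on, and
    [floor_exp y] counts the terms whose integral covers [y]. With
    [w y = s * exp (- s * y)] this is the formula
    [zeta s = s * \int floor (e^y) * e^(- s * y) dy]. *)
Lemma dirichlet_series_floor w W x C : 1 < x -> continuous w ->
  (forall y, `|w y| <= C * expR (- x * y)) ->
  (forall a, 0 <= a -> \int[mu]_(y in `[a, +oo[) w y = W a) ->
  series (fun k => W (ln k.+1%:R)) @ \oo -->
    \int[mu]_(y in `[0, +oo[) (floor_exp y * w y).
Proof.
move=> x1 cw wC Ww.
have mw := measurable_continuous cw.
have dom : integ `[0, +oo[ (fun y => C * expR (- (x - 1) * y)).
  by apply: integZ => //; apply: integ_expRNM; rewrite subr_gt0.
have C0 : 0 <= C.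
  have := le_trans (normr_ge0 _) (wC 0); by rewrite pmulr_lge0// expR_gt0.
have bd (m : R) y : 0 <= m -> m <= expR y ->
    `|m * w y| <= C * expR (- (x - 1) * y).
  move=> m0 me; rewrite normrM ger0_norm//.
  have -> : C * expR (- (x - 1) * y) = expR y * (C * expR (- x * y)).
    by rewrite mulrCA -expRD; congr (_ * expR _); ring.
  by apply: ler_pM.
have step_le n y : step n y <= expR y.
  rewrite stepE (le_trans _ (floor_exp_le y))// /floor_exp ler_nat geq_minr//.
have step_ge0 n y : 0 <= step n y by rewrite stepE ler0n.
have istep n : integ `[0, +oo[ (fun y => step n y * w y).
  apply: (integ_le _ _ dom) => //; first exact: measurable_funTS (measurable_funM _ _).
  by move=> y _; exact: bd.
rewrite (_ : series _ = fun n => \int[mu]_(y in `[0, +oo[) (step n y * w y)).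
  apply: (Rdominated_cvg _ _ _ _ dom) => //.
  - by move=> n; exact: integ_measurable.
  - by apply: measurable_funTS; apply: measurable_funM => //; exact: measurable_floor_exp.
  - by apply: aeW => y _; apply: cvgMl; exact: step_cvg.
  - by move=> n y _; exact: bd.
apply/funext => n; rewrite /series /=; elim: n => [|n IHn].
  rewrite big_nil; under eq_Rintegral do rewrite /step big_nil mul0r.
  by rewrite Rintegral_cst// mul0r.
rewrite big_nat_recr//= IHn -Ww ?ln_ge0 ?ler1n//.
have iw : integ `[0, +oo[ (fun y => (ln n.+1%:R <= y)%R%:R * w y).
  rewrite (_ : (fun y => _) = fun y => step n.+1 y * w y + (- 1) * (step n y * w y)).
    by apply: integD => //; exact: integZ.
  by apply/funext => y; rewrite {1}/step big_nat_recr//= -/(step n y); ring.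
transitivity (\int[mu]_(y in `[0, +oo[) (step n y * w y) +
  \int[mu]_(y in `[0, +oo[) ((ln n.+1%:R <= y)%R%:R * w y)).
  congr (_ + _); rewrite Rintegral_mkcond [RHS]Rintegral_mkcond.
  apply: eq_Rintegral => y _; rewrite !patchE !mem_setE !in_itv/= !andbT.
  have [lny|] := leP (ln n.+1%:R) y; last by case: ifP; rewrite ?mul0r.
  by rewrite (le_trans _ lny) ?ln_ge0 ?ler1n// mul1r.
rewrite -RintegralD//; apply: eq_Rintegral => y _.
by rewrite {2}/step big_nat_recr//= -/(step n y) mulrDl.
Qed.

End dirichlet.

(** * The zeta function on horizontal lines *)

Section zeta_on_lines.
Context {R : realType}.
Local Notation mu := (@lebesgue_measure R).
Local Notation integ D f := (mu.-integrable D (EFin \o f)).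
Local Open Scope complex_scope.
Implicit Types (x t y a : R) (zeta : R[i] -> R[i]).

(** This lemma and the next are the real part and the opposite of the imaginary
    part of [\int_(y >= a) s * e^(- s * y) dy = e^(- s * a)] for
    [s = x +i* t]. *)
Lemma Rintegral_expRN_tail_cos x t a : 0 < x -> 0 <= a ->
  \int[mu]_(y in `[a, +oo[) (expR (- x * y) * (x * cos (t * y) + t * sin (t * y))) =
  expR (- x * a) * cos (t * a).
Proof.
move=> x0 a0.
have dF y : is_derive y 1 (fun y => - (expR (- x * y) * cos (t * y)))
    (expR (- x * y) * (x * cos (t * y) + t * sin (t * y))).
  by apply: is_derive_eq; rewrite /GRing.scale/=; ring.
have ck : continuous (fun y => x * cos (t * y) + t * sin (t * y)).
  move=> y; apply: cvgD; apply: cvgMr; [exact: continuous_cosM|exact: continuous_sinM].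
rewrite (Rintegral_FTC2y (l := 0) _ dF) ?sub0r ?opprK//.
- by move=> y; apply: cvgM; [exact: continuous_expRM|exact: ck].
- have := @integ_expRNM_bounded _ x _ (`|x| + `|t|) x0 ck.
  move=> /(_ _)/(integrableS _ _) -> //.
  + by move=> y /=; rewrite !in_itv/= !andbT; exact: le_trans.
  + by move=> y; rewrite (le_trans (ler_normD _ _))// lerD// normrM ler_piMr//
     ?norm_sin_le1 ?norm_cos_le1.
- rewrite -oppr0; apply: cvgN; apply: (@cvg_expRNM_bounded _ _ _ 1) => //.
  by move=> y; exact: norm_cos_le1.
Qed.

Lemma Rintegral_expRN_tail_sin x t a : 0 < x -> 0 <= a ->
  \int[mu]_(y in `[a, +oo[) (expR (- x * y) * (x * sin (t * y) - t * cos (t * y))) =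
  expR (- x * a) * sin (t * a).
Proof.
move=> x0 a0.
have dF y : is_derive y 1 (fun y => - (expR (- x * y) * sin (t * y)))
    (expR (- x * y) * (x * sin (t * y) - t * cos (t * y))).
  by apply: is_derive_eq; rewrite /GRing.scale/=; ring.
have ck : continuous (fun y => x * sin (t * y) - t * cos (t * y)).
  move=> y; apply: cvgB; apply: cvgMr; [exact: continuous_sinM|exact: continuous_cosM].
rewrite (Rintegral_FTC2y (l := 0) _ dF) ?sub0r ?opprK//.
- by move=> y; apply: cvgM; [exact: continuous_expRM|exact: ck].
- have := @integ_expRNM_bounded _ x _ (`|x| + `|t|) x0 ck.
  move=> /(_ _)/(integrableS _ _) -> //.
  + by move=> y /=; rewrite !in_itv/= !andbT; exact: le_trans.
  + by move=> y; rewrite (le_trans (ler_normB _ _))// lerD// normrM ler_piMr//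
     ?norm_sin_le1 ?norm_cos_le1.
- rewrite -oppr0; apply: cvgN; apply: (@cvg_expRNM_bounded _ _ _ 1) => //.
  by move=> y; exact: norm_sin_le1.
Qed.

Lemma fracpart_expR_ge0 y : 0 <= fracpart (expR y).
Proof. by rewrite fracpart_expRE subr_ge0 floor_exp_le. Qed.

Lemma fracpart_expR_le1 y : fracpart (expR y) <= 1.
Proof.
rewrite /fracpart lerBlDl; apply: ltW; rewrite -[1]/(1%:~R) -intrD.
exact: floorD1_gt.
Qed.

Lemma norm_fracpart_expR y : `|fracpart (expR y)| <= 1.
Proof. by rewrite ger0_norm ?fracpart_expR_ge0 ?fracpart_expR_le1. Qed.

Lemma measurable_fracpart_expR : measurable_fun setT (fun y => fracpart (expR y)).
Proof.
under eq_fun do rewrite fracpart_expRE.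
by apply: measurable_funB; [exact: measurable_expR|exact: measurable_floor_exp].
Qed.

(** For [s = x +i* t], the integral of [{e^y} * e^(- s * y)] over [y >= 0] is
    [frac_cos t x - i * frac_sin t x]. *)
Definition frac_cos t x := laplace (fun y => fracpart (expR y) * cos (t * y)) x.
Definition frac_sin t x := laplace (fun y => fracpart (expR y) * sin (t * y)) x.

Lemma analytic_frac_cos t x : 0 < x -> real_analytic_at (frac_cos t) x.
Proof.
apply: (@laplace_analytic _ _ 1).
- by apply: measurable_funM; [exact: measurable_fracpart_expR|exact: measurable_cosM].
- by move=> y; rewrite normrM mulr_ile1 ?norm_fracpart_expR ?norm_cos_le1.
Qed.

Lemma analytic_frac_sin t x : 0 < x -> real_analytic_at (frac_sin t) x.
Proof.
apply: (@laplace_analytic _ _ 1).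
- by apply: measurable_funM; [exact: measurable_fracpart_expR|exact: measurable_sinM].
- by move=> y; rewrite normrM mulr_ile1 ?norm_fracpart_expR ?norm_sin_le1.
Qed.

Lemma integ_frac_bounded x (k : R -> R) : 0 < x -> measurable_fun setT k ->
  (forall y, `|k y| <= 1) ->
  integ `[0, +oo[ (fun y => fracpart (expR y) * k y * expR (- x * y)).
Proof.
move=> x0 mk k1.
rewrite (_ : (fun y => _) =
    (fun y => expR (- x * y) * (fracpart (expR y) * k y))); last first.
  by apply/funext => y; rewrite [RHS]mulrC.
apply: (@integ_mul_bounded _ _ _ _ 1) => //; first exact: integ_expRNM.
- apply: measurable_funTS; apply: measurable_funM => //.
  exact: measurable_fracpart_expR.
- by move=> y _; rewrite normrM mulr_ile1 ?norm_fracpart_expR.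
Qed.

(** The real part of [zeta s = s / (s - 1) - s * K s] for [s = x +i* t], where
    [K s] is the integral of [{e^y} * e^(- s * y)] over [y >= 0]: replace
    [floor (e^y)] by [e^y - {e^y}] in the Dirichlet series. *)
Lemma zeta_Re_gt1 zeta x t : is_riemann_zeta zeta -> 1 < x ->
  complex.Re (zeta (x +i* t)) =
  (x * (x - 1) + t ^+ 2) / ((x - 1) ^+ 2 + t ^+ 2) -
  (x * frac_cos t x + t * frac_sin t x).
Proof.
move=> [zs _] x1; have x0 : 0 < x by exact: lt_trans x1.
have c0 : 0 < x - 1 by rewrite subr_gt0.
pose w y := expR (- x * y) * (x * cos (t * y) + t * sin (t * y)).
have cw : continuous w.
  move=> y; apply: cvgM; first exact: continuous_expRM.
  by apply: cvgD; apply: cvgMr; [exact: continuous_cosM|exact: continuous_sinM].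
have wb y : `|w y| <= (`|x| + `|t|) * expR (- x * y).
  rewrite /w mulrC normrM [`|expR _|]ger0_norm ?expR_ge0// ler_wpM2r ?expR_ge0//.
  by rewrite (le_trans (ler_normD _ _))// lerD// normrM ler_piMr//
     ?norm_sin_le1 ?norm_cos_le1.
have := dirichlet_series_floor x1 cw wb (fun a => Rintegral_expRN_tail_cos t x0).
have := cvg_Re (zs (x +i* t) x1).
rewrite (_ : (fun n => complex.Re _) =
    series (fun k => expR (- x * ln k.+1%:R) * cos (t * ln k.+1%:R))); last first.
  apply/funext => n; rewrite /series /= raddf_sum; apply: eq_bigr => k _.
  by rewrite natpowNE.
move=> /(cvg_unique _) zeq /zeq -> //.
have ic := integ_expRNM_bounded c0 (@continuous_cosM R t) (fun y => norm_cos_le1 (t * y)).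
have isn := integ_expRNM_bounded c0 (@continuous_sinM R t) (fun y => norm_sin_le1 (t * y)).
have ifc := integ_frac_bounded x0 (measurable_cosM t) (fun y => norm_cos_le1 (t * y)).
have ifs := integ_frac_bounded x0 (measurable_sinM t) (fun y => norm_sin_le1 (t * y)).
transitivity (\int[mu]_(y in `[0, +oo[) (
   (x * (expR (- (x - 1) * y) * cos (t * y)) + t * (expR (- (x - 1) * y) * sin (t * y)))
   - (x * (fracpart (expR y) * cos (t * y) * expR (- x * y)) +
      t * (fracpart (expR y) * sin (t * y) * expR (- x * y))))).
  apply: eq_Rintegral => y _; rewrite fracpart_expRE /w.
  have -> : expR (- (x - 1) * y) = expR y * expR (- x * y).
    by rewrite -expRD; congr expR; ring.
  ring.
rewrite RintegralB//; last 2 first.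
- by apply: integD => //; exact: integZ.
- by apply: integD => //; exact: integZ.
rewrite !Rintegral_lincomb// Rintegral_expRN_cos// Rintegral_expRN_sin//.
congr (_ - _); rewrite !mulrA -mulrDl; congr (_ / _); ring.
Qed.

(** The opposite of the imaginary part of the same formula, since the imaginary
    part of [s / (s - 1)] is [- t / `|s - 1|^2]. *)
Lemma zeta_Im_gt1 zeta x t : is_riemann_zeta zeta -> 1 < x ->
  - complex.Im (zeta (x +i* t)) =
  t / ((x - 1) ^+ 2 + t ^+ 2) - (x * frac_sin t x - t * frac_cos t x).
Proof.
move=> [zs _] x1; have x0 : 0 < x by exact: lt_trans x1.
have c0 : 0 < x - 1 by rewrite subr_gt0.
pose w y := expR (- x * y) * (x * sin (t * y) - t * cos (t * y)).
have cw : continuous w.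
  move=> y; apply: cvgM; first exact: continuous_expRM.
  by apply: cvgB; apply: cvgMr; [exact: continuous_sinM|exact: continuous_cosM].
have wb y : `|w y| <= (`|x| + `|t|) * expR (- x * y).
  rewrite /w mulrC normrM [`|expR _|]ger0_norm ?expR_ge0// ler_wpM2r ?expR_ge0//.
  by rewrite (le_trans (ler_normB _ _))// lerD// normrM ler_piMr//
     ?norm_sin_le1 ?norm_cos_le1.
have := dirichlet_series_floor x1 cw wb (fun a => Rintegral_expRN_tail_sin t x0).
have zc : series (fun k => expR (- x * ln k.+1%:R) * sin (t * ln k.+1%:R)) n
    @[n --> \oo] --> - complex.Im (zeta (x +i* t)).
  rewrite (_ : series _ = - (fun n => complex.Im
      (series (fun k => natpowN k.+1 (x +i* t)) n))).
    by apply: cvgN; exact: (cvg_Im (zs (x +i* t) x1)).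
  apply/funext => n; rewrite fctE /series /= raddf_sum -sumrN; apply: eq_bigr => k _.
  by rewrite natpowNE /= opprK.
move=> /(cvg_unique _ zc) -> //.
have ic := integ_expRNM_bounded c0 (@continuous_cosM R t) (fun y => norm_cos_le1 (t * y)).
have isn := integ_expRNM_bounded c0 (@continuous_sinM R t) (fun y => norm_sin_le1 (t * y)).
have ifc := integ_frac_bounded x0 (measurable_cosM t) (fun y => norm_cos_le1 (t * y)).
have ifs := integ_frac_bounded x0 (measurable_sinM t) (fun y => norm_sin_le1 (t * y)).
transitivity (\int[mu]_(y in `[0, +oo[) (
   (x * (expR (- (x - 1) * y) * sin (t * y)) +
    - t * (expR (- (x - 1) * y) * cos (t * y)))
   - (x * (fracpart (expR y) * sin (t * y) * expR (- x * y)) +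
      - t * (fracpart (expR y) * cos (t * y) * expR (- x * y))))).
  apply: eq_Rintegral => y _; rewrite fracpart_expRE /w.
  have -> : expR (- (x - 1) * y) = expR y * expR (- x * y).
    by rewrite -expRD; congr expR; ring.
  ring.
rewrite RintegralB//; last 2 first.
- by apply: integD => //; exact: integZ.
- by apply: integD => //; exact: integZ.
rewrite !Rintegral_lincomb// Rintegral_expRN_cos// Rintegral_expRN_sin//.
rewrite mulNr [- t * \int[_]_(_ in _) _]mulNr.
congr (_ - _); rewrite !mulrA -mulrBl; congr (_ / _); ring.
Qed.

Lemma real_analytic_quadratic f x0 t : real_analytic_at f x0 ->
  real_analytic_at (fun x => ((x - 1) ^+ 2 + t ^+ 2) * f x) x0.
Proof.
move=> af.
rewrite (_ : (fun x => _) = fun x => x * (x * f x) +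
   ((- 2) * (x * f x) + (1 + t ^+ 2) * f x)); last by apply/funext => x; ring.
have axf := real_analyticMid af.
apply: real_analyticD; first exact: real_analyticMid.
by apply: real_analyticD; exact: real_analyticZ.
Qed.

Lemma horizontal_line_neq1 x t : t != 0 -> (x +i* t)%C != 1.
Proof. by move=> t0; rewrite eq_complex /= negb_and t0 orbT. Qed.

(** The horizontal line through [i t] avoids the pole, so that the identity
    theorem along it carries the formula from [1 < x] to [0 < x]. Clearing the
    denominator [`|s - 1|^2] leaves a function built from analytic ones by sums
    and products with polynomials. *)
Lemma zeta_Re zeta x t : is_riemann_zeta zeta -> t != 0 -> 0 < x ->
  complex.Re (zeta (x +i* t)) =
  (x * (x - 1) + t ^+ 2) / ((x - 1) ^+ 2 + t ^+ 2) -
  (x * frac_cos t x + t * frac_sin t x).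
Proof.
move=> zetaP t0 x0.
have d0 y : 0 < (y - 1) ^+ 2 + t ^+ 2.
  by rewrite ltr_wpDl ?sqr_ge0// exprn_even_gt0.
pose D y := ((y - 1) ^+ 2 + t ^+ 2) * (complex.Re (zeta (y +i* t)) +
  (y * frac_cos t y + t * frac_sin t y)) + - 1 * (y * (y * 1 + - 1) + t ^+ 2).
suff : D x = 0.
  rewrite /D => Dx; apply: (mulfI (lt0r_neq0 (d0 x))).
  rewrite mulrBr mulrCA divff ?lt0r_neq0// mulr1.
  by apply/eqP; rewrite -subr_eq0 -[X in _ == X]Dx; apply/eqP; ring.
apply: real_analytic_identity x0 => y y0.
  apply: real_analyticD; last first.
    apply: real_analyticZ; apply: real_analyticD; last exact: real_analytic_cst.
    apply: real_analyticMid; apply: real_analyticD; last exact: real_analytic_cst.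
    by apply: real_analyticMid; exact: real_analytic_cst.
  apply: real_analytic_quadratic; apply: real_analyticD.
    by apply: (analytic_at_real_line _).1; apply: zetaP.2; exact: horizontal_line_neq1.
  apply: real_analyticD.
    by apply: real_analyticMid; exact: analytic_frac_cos.
  by apply: real_analyticZ; exact: analytic_frac_sin.
rewrite /D zeta_Re_gt1// subrK; field.
by rewrite lt0r_neq0.
Qed.

Lemma zeta_Im zeta x t : is_riemann_zeta zeta -> t != 0 -> 0 < x ->
  - complex.Im (zeta (x +i* t)) =
  t / ((x - 1) ^+ 2 + t ^+ 2) - (x * frac_sin t x - t * frac_cos t x).
Proof.
move=> zetaP t0 x0.
have d0 y : 0 < (y - 1) ^+ 2 + t ^+ 2.
  by rewrite ltr_wpDl ?sqr_ge0// exprn_even_gt0.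
pose D y := ((y - 1) ^+ 2 + t ^+ 2) * (- 1 * complex.Im (zeta (y +i* t)) +
  (y * frac_sin t y + - t * frac_cos t y)) + - t.
suff : D x = 0.
  rewrite /D => Dx; apply: (mulfI (lt0r_neq0 (d0 x))).
  rewrite mulrBr mulrCA divff ?lt0r_neq0// mulr1.
  by apply/eqP; rewrite -subr_eq0 -[X in _ == X]Dx; apply/eqP; ring.
apply: real_analytic_identity x0 => y y0.
  apply: real_analyticD; last exact: real_analytic_cst.
  apply: real_analytic_quadratic; apply: real_analyticD.
    apply: real_analyticZ.
    by apply: (analytic_at_real_line _).2; apply: zetaP.2; exact: horizontal_line_neq1.
  apply: real_analyticD.
    by apply: real_analyticMid; exact: analytic_frac_sin.
  by apply: real_analyticZ; exact: analytic_frac_cos.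
rewrite /D mulN1r zeta_Im_gt1// mulNr subrK; field.
by rewrite lt0r_neq0.
Qed.

End zeta_on_lines.

(** * The Mellin transform of the fractional part *)

Section parseval_zeta.
Context {R : realType}.
Local Notation mu := (@lebesgue_measure R).
Local Notation integ D f := (mu.-integrable D (EFin \o f)).
Context (sigma : R) (sigma_gt0 : 0 < sigma) (sigma_lt1 : sigma < 1).
Local Open Scope complex_scope.
Implicit Types (t x y : R).

Let onesigma_gt0 : 0 < 1 - sigma. Proof. by rewrite subr_gt0. Qed.

(** The function [{x} * x^(- sigma)] in the variable [y = ln x]. *)
Definition frac_weight y := fracpart (expR y) * expR (- sigma * y).

Lemma frac_weight_ge0 y : 0 <= frac_weight y.
Proof. by rewrite mulr_ge0 ?expR_ge0// fracpart_expR_ge0. Qed.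

Lemma frac_weightN y : 0 < y -> frac_weight (- y) = expR (- (1 - sigma) * y).
Proof.
move=> y0; rewrite /frac_weight /fracpart.
rewrite (_ : Num.floor _ = 0) ?subr0.
  by rewrite -expRD; congr expR; ring.
by apply/eqP; rewrite floor_eq expR_ge0/= add0r expR_lt1 oppr_lt0.
Qed.

Lemma Rintegral_half_lines (f : R -> R) : integ `[0, +oo[ f ->
  integ `]0, +oo[ (fun y => f (- y)) ->
  integ setT f /\ \int[mu]_y f y =
    \int[mu]_(y in `[0, +oo[) f y + \int[mu]_(y in `]0, +oo[) f (- y).
Proof.
move=> ip iN.
pose p := f \_ `[0, +oo[%classic; pose q := (fun y => f (- y)) \_ `]0, +oo[%classic.
have iP : integ setT p by move: ip; rewrite integrable_mkcond// restrict_EFin.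
have iq : integ setT q by move: iN; rewrite integrable_mkcond// restrict_EFin.
have fE : f = fun y => p y + q (- y).
  apply/funext => y; rewrite /p /q !patchE !mem_setE !in_itv/= !andbT oppr_gt0 opprK.
  by case: leP => _; rewrite ?addr0 ?add0r.
have iqN := integ_opp iq.
rewrite {1 2}fE; split; first exact: integD.
rewrite RintegralD// (Rintegral_opp iq).
by rewrite [in RHS]Rintegral_mkcond [X in _ = _ + X]Rintegral_mkcond.
Qed.

Lemma integ_frac_weight_bounded (k : R -> R) : continuous k ->
  (forall y, `|k y| <= 1) ->
  integ setT (fun y => frac_weight y * k y) /\
  \int[mu]_y (frac_weight y * k y) =
    laplace (fun y => fracpart (expR y) * k y) sigma +
    \int[mu]_(y in `[0, +oo[) (expR (- (1 - sigma) * y) * k (- y)).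
Proof.
move=> ck k1; have mk := measurable_continuous ck.
have ckN : continuous (fun y => k (- y)).
  by move=> y; apply: continuous_comp; [exact: continuousN|exact: ck].
have i2 : integ `]0, +oo[ (fun y => expR (- (1 - sigma) * y) * k (- y)).
  apply: (@integrableS _ _ _ mu `[0, +oo[%classic) => //.
    by move=> y /=; rewrite !in_itv/= !andbT; exact: ltW.
  by apply: (@integ_expRNM_bounded _ _ _ 1).
have wE : (fun y => frac_weight y * k y) =
    fun y => fracpart (expR y) * k y * expR (- sigma * y).
  by apply/funext => y; rewrite /frac_weight; ring.
have [||i3 ->] := @Rintegral_half_lines (fun y => frac_weight y * k y).
- by rewrite wE; exact: integ_frac_bounded.
- apply: eq_integrable i2 => // y; rewrite inE/= in_itv/= andbT => y0.
  by rewrite frac_weightN.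
split => //; congr (_ + _); first by rewrite /laplace wE.
rewrite -Rintegral_itv_obnd_cbnd//; apply: eq_Rintegral => y.
by rewrite inE/= in_itv/= andbT => y0; rewrite frac_weightN.
Qed.

Lemma nice_frac_weight : nice frac_weight.
Proof.
split.
- exact: frac_weight_ge0.
- exists 1 => y; have [y0|y0] := leP 0 y.
    rewrite /frac_weight mulr_ile1 ?expR_ge0 ?fracpart_expR_ge0 ?fracpart_expR_le1//.
    by rewrite -[leRHS]expR0 ler_expR mulNr oppr_le0 mulr_ge0// ltW.
  rewrite -(opprK y) frac_weightN ?oppr_gt0// -[leRHS]expR0 ler_expR.
  by rewrite mulNr oppr_le0 mulr_ge0 ?oppr_ge0 ?ltW.
- have [|y|+ _] := @integ_frac_weight_bounded (cst 1).
  + by move=> y; exact: cvg_cst.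
  + by rewrite normr1.
  + by rewrite (_ : (fun y => _) = frac_weight)//; apply/funext => y; rewrite mulr1.
- exists [set ln k.+1%:R | k in [set: nat]].
    exact: (sub_countable (card_image_le _ _)).
  move=> y yN; set n := Num.truncn (expR y).
  have ny : n%:R < expR y.
    rewrite lt_neqAle truncn_le ?expR_ge0// andbT; apply/eqP => ny.
    apply: yN; case: n ny => [ny|k ny]; last by exists k => //; rewrite ny expRK.
    by have := expR_gt0 y; rewrite -ny ltxx.
  have yn1 : expR y < n.+1%:R by rewrite -truncn_le_nat.
  have : (expR z - n%:R) * expR (- sigma * z) @[z --> y] --> frac_weight y.
    rewrite /frac_weight fracpart_expRE; apply: cvgM; last exact: continuous_expRM.
    by apply: cvgB; [exact: continuous_expR|exact: cvg_cst].
  apply: cvg_trans; apply: near_eq_cvg; near=> z.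
  rewrite /frac_weight fracpart_expRE /floor_exp; congr ((_ - _%:R) * _).
  apply/eqP; rewrite eqn_leq truncn_ge_nat ?expR_ge0// truncn_le_nat.
  apply/andP; split.
    by apply: ltW; near: z; apply: cvgr_gt ny; exact: continuous_expR.
  by near: z; apply: cvgr_lt yn1; exact: continuous_expR.
Unshelve. all: by end_near. Qed.

(** The Fourier transform of [frac_weight] at [t] is [- zeta s / s] for
    [s = sigma +i* t]: the half-line [y < 0], where [{e^y} = e^y], contributes
    [1 / (1 - s)], which cancels the term [s / (s - 1)] of [zeta s]. *)
Lemma power_spectrum_frac_weight zeta t : is_riemann_zeta zeta -> t != 0 ->
  power_spectrum frac_weight t =
  cmod (zeta (sigma +i* t)) ^+ 2 / (sigma ^+ 2 + t ^+ 2).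
Proof.
move=> zetaP t0.
have d0 : 0 < (1 - sigma) ^+ 2 + t ^+ 2 by exact: sumsqr_gt0.
have d0' : 0 < (sigma - 1) ^+ 2 + t ^+ 2 by rewrite -(sqrrN (sigma - 1)) opprB.
have s0 : 0 < sigma ^+ 2 + t ^+ 2 by exact: sumsqr_gt0.
have -> : cmod (zeta (sigma +i* t)) ^+ 2 =
    complex.Re (zeta (sigma +i* t)) ^+ 2 + (- complex.Im (zeta (sigma +i* t))) ^+ 2.
  by rewrite sqrrN /cmod; case: (zeta _) => a b /=; rewrite sqr_sqrtr// addr_ge0// sqr_ge0.
rewrite zeta_Re// zeta_Im// /power_spectrum.
have -> : cosT frac_weight t = frac_cos t sigma + (1 - sigma) / ((1 - sigma) ^+ 2 + t ^+ 2).
  rewrite /cosT (integ_frac_weight_bounded (@continuous_cosM R t) _).2.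
    rewrite -(Rintegral_expRN_cos t onesigma_gt0); congr (_ + _).
    by apply: eq_Rintegral => y _; rewrite mulrN cosN.
  by move=> y; exact: norm_cos_le1.
have -> : sinT frac_weight t = frac_sin t sigma - t / ((1 - sigma) ^+ 2 + t ^+ 2).
  rewrite /sinT (integ_frac_weight_bounded (@continuous_sinM R t) _).2; last first.
    by move=> y; exact: norm_sin_le1.
  rewrite -(Rintegral_expRN_sin t onesigma_gt0); congr (_ + _).
  rewrite -[RHS]mulN1r -RintegralZl//.
    by apply: eq_Rintegral => y _; rewrite mulrN sinN mulrN mulN1r.
  apply: (@integ_expRNM_bounded _ _ _ 1) => //; first exact: continuous_sinM.
  by move=> y; exact: norm_sin_le1.
by field; rewrite !lt0r_neq0.
Qed.

Definition frac_conv m := iter m (conv frac_weight) frac_weight.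

Lemma nice_frac_conv m : nice (frac_conv m).
Proof.
elim: m => [|m IHm]; first exact: nice_frac_weight.
by apply: nice_conv => //; exact: nice_frac_weight.
Qed.

Lemma power_spectrum_frac_conv m t :
  power_spectrum (frac_conv m) t = power_spectrum frac_weight t ^+ m.+1.
Proof.
elim: m => [//|m IHm]; rewrite /frac_conv iterS -/(frac_conv m).
rewrite power_spectrum_conv ?IHm ?exprS//; first exact: nice_frac_weight.
exact: nice_frac_conv.
Qed.

Lemma measurable_expRN_ln : measurable_fun setT (fun x : R => expR (- ln x)).
Proof.
apply: (measurableT_comp (@measurable_expR R)).
by apply: measurableT_comp => //; exact: measurable_ln.
Qed.

(** The substitution [u = e^v] turns the multiplicative convolution that defines
    [phi] into [conv], the powers [x^(- sigma)] being multiplicative. *)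
Lemma phi_expR m y : phi m.+1 (expR y) = frac_conv m y * expR (sigma * y).
Proof.
elim: m y => [|m IHm] y.
  rewrite /frac_conv /= /frac_weight -mulrA -expRD.
  by rewrite mulNr addNr expR0 mulr1.
pose h v := frac_weight v * frac_conv m (y - v) * expR (sigma * y).
have ih := nice_conv_integ y nice_frac_weight (nice_frac_conv m).
have mh : measurable_fun setT h.
  by apply: measurable_funM => //; exact: integ_measurable.
(* [h (ln u) / u] is the integrand that defines [phi m.+2 (expR y)]. *)
have hE u : 0 < u -> fracpart u * phi m.+1 (expR y / u) / u = h (ln u) * expR (- ln u).
  move=> u0; rewrite -{1 2 3}(lnK (x := u)) ?posrE// -expRN -expRD IHm /h /frac_weight.
  have -> : expR (sigma * y) = expR (sigma * (y - ln u)) * expR (sigma * ln u).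
    by rewrite -expRD; congr expR; ring.
  rewrite -[LHS]mulr1 -(expR0 R) -[0](subrr (sigma * ln u)) expRD mulNr; ring.
rewrite [LHS]/=.
transitivity (\int[mu]_v h v); last first.
  by rewrite /h RintegralZr.
congr fine; rewrite ge0_integral_expR.
- apply: eq_integral => v _; rewrite hE ?expR_gt0// expRK -mulrA -expRD.
  by rewrite addNr expR0 mulr1.
- apply: (eq_measurable_fun (fun u => h (ln u) * expR (- ln u))).
    by move=> u; rewrite inE/= in_itv/= andbT => u0; rewrite hE.
  apply: measurable_funTS; apply: measurable_funM.
    by apply: measurableT_comp => //; exact: measurable_ln.
  exact: measurable_expRN_ln.
- move=> u u0; rewrite hE// mulr_ge0 ?expR_ge0// /h mulr_ge0 ?expR_ge0//.
  rewrite mulr_ge0 ?frac_weight_ge0//.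
  exact: (nice_ge0 (nice_frac_conv m)).
Qed.

End parseval_zeta.

(** * The mean value identity *)

Local Open Scope complex_scope.

Theorem corollary1 (R : realType) (zeta : R[i] -> R[i])
    (zetaP : is_riemann_zeta zeta) (n : nat) (n_ge1 : (1 <= n)%N)
    (sigma : R) (sigma_gt0 : 0 < sigma) (sigma_lt1 : sigma < 1) :
  let F (t : R) : R :=
    cmod (zeta (sigma +i* t)) ^+ (2 * n) / (sigma ^+ 2 + t ^+ 2) ^+ n in
  let G (x : R) : R := phi n x ^+ 2 * x `^ (- 1 - 2 * sigma) in
  [/\ (@lebesgue_measure R).-integrable setT (EFin \o F),
      (@lebesgue_measure R).-integrable `]0, +oo[ (EFin \o G) &
      (2 * pi)^-1 * (\int[@lebesgue_measure R]_t F t) =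
      \int[@lebesgue_measure R]_(x in `]0, +oo[) G x].
Proof.
case: n n_ge1 => // m _ F G.
pose mu := @lebesgue_measure R.
pose g := frac_conv sigma m; have ng : nice g by exact: nice_frac_conv.
pose P := power_spectrum g.
have P0 t : 0 <= P t by exact: power_spectrum_ge0.
have FP t : t != 0 -> F t = P t.
  move=> t0; rewrite /P power_spectrum_frac_conv// (power_spectrum_frac_weight _ _ zetaP)//.
  by rewrite expr_div_n -exprM.
have iP : mu.-integrable setT (EFin \o P).
  apply/integrableP; split.
    apply/measurable_EFinP; apply: measurable_continuous.
    rewrite (_ : P = cosT (autocorrelation g)).
      by apply: continuous_cosT; exact: nice_autocorrelation.
    by apply/funext => t; rewrite cosT_autocorrelation.
  under eq_integral => t _ do rewrite /= ger0_norm//.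
  by rewrite plancherel// ltry.
(* The formula for zeta holds off the real axis, so [F] and [P] may differ at the
   single point [0]; their difference is a multiple of [I0]. *)
pose I0 : R -> R := \1_([set 0] : set R).
have eI0 : (\int[mu]_t (I0 t)%:E = 0)%E.
  transitivity (mu [set 0]); last exact: lebesgue_measure_set1.
  by rewrite /I0 integral_indic// setIT.
have iI0 : mu.-integrable setT (EFin \o I0).
  apply/integrableP; split.
    by apply/measurable_EFinP; exact: measurable_indic.
  under eq_integral => t _ do rewrite /= ger0_norm//.
  by rewrite eI0 ltry.
have FE : F = fun t => P t + (F 0 - P 0) * I0 t.
  apply/funext => t; rewrite /I0 indicE; have [->|t0] := eqVneq t 0.
    by rewrite mem_set// mulr1 addrC subrK.
  by rewrite memNset ?mulr0 ?addr0 ?FP//; exact/eqP.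
have iF : mu.-integrable setT (EFin \o F).
  by rewrite FE; apply: integD => //; exact: integZ.
have intF : \int[mu]_t F t = 2 * pi * \int[mu]_x (g x ^+ 2).
  rewrite FE RintegralD//; last exact: integZ.
  by rewrite RintegralZl// [X in _ * X]/Rintegral eI0 mulr0 addr0 /Rintegral plancherel.
have GE x : 0 < x -> G x = g (ln x) ^+ 2 * expR (- ln x).
  move=> x0; rewrite /G -{1}(lnK (x := x)) ?posrE// (phi_expR sigma_gt0 sigma_lt1).
  rewrite /powR gt_eqF// exprMn -mulrA; congr (_ * _).
  by rewrite expr2 -!expRD; congr expR; ring.
have mG : measurable_fun (`]0, +oo[ : set R) G.
  apply: (eq_measurable_fun (fun x => g (ln x) ^+ 2 * expR (- ln x))).
    by move=> x; rewrite inE/= in_itv/= andbT => x0; rewrite GE.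
  apply: measurable_funTS; apply: measurable_funM.
    apply: measurable_funX; apply: measurableT_comp; last exact: measurable_ln.
    exact: nice_measurable.
  exact: measurable_expRN_ln.
have G0 x : 0 < x -> 0 <= G x.
  by move=> x0; rewrite GE// mulr_ge0 ?sqr_ge0 ?expR_ge0.
have ig2 : mu.-integrable setT (EFin \o (fun x => g x ^+ 2)).
  have [M gM] := nice_bounded ng; under eq_fun do rewrite expr2.
  apply: (@integ_mul_bounded _ _ _ _ M) => //; first exact: nice_integ.
    exact: nice_measurable.
  by move=> x _; rewrite ger0_norm// nice_ge0.
have intG : (\int[mu]_(x in `]0%R, +oo[) (G x)%:E = (\int[mu]_x (g x ^+ 2))%:E)%E.
  rewrite ge0_integral_expR// EFin_Rintegral//; apply: eq_integral => y _.
  by rewrite GE ?expR_gt0// expRK -mulrA -expRD addNr expR0 mulr1.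
split => //.
  apply/integrableP; split; first exact/measurable_EFinP.
  under eq_integral => x.
    rewrite inE/= in_itv/= andbT => x0; rewrite ger0_norm ?G0//; over.
  by rewrite intG ltry.
rewrite intF mulKf; first by rewrite /Rintegral intG.
by rewrite mulf_neq0// gt_eqF// pi_gt0.
Qed.
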